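(* Let $m\ge2$, $G=G(m,m,2)<\mathrm{GL}_2(\mathbb{C})<\mathrm{Sp}_4(\mathbb{C})$ (the Coxeter group $I_2(m)$), $V=\mathbb{C}^4$, $X=\mathbb{C}^2$. Then $\mathsf{HP}_0(\mathcal{O}_V^G,\mathcal{O}_V)\cong\mathrm{gr}\,\mathsf{HH}_0(\mathcal{D}_X^G,\mathcal{D}_X)$, and a homogeneous basis of the former is given by the images of the elements $$x_1^ay_1^a+(-1)^ax_2^ay_2^a,\qquad 0\le a\le m-2.$$
   Context: $G(m,m,2)$ is the group generated by $\mathrm{diag}(e^{2\pi i/m},e^{-2\pi i/m})$ and $\begin{pmatrix}0&1\\1&0\end{pmatrix}$. $V=X\oplus X^*$, and $\mathrm{GL}(X)<\mathrm{Sp}(V)$ via $A\mapsto A\oplus(A^{-1})^*$. $\mathcal{O}_V=\mathbb{C}[x_1,x_2,y_1,y_2]$ is graded by polynomial degree, with $\{x_i,y_j\}=\delta_{ij}$, $\{x_i,x_j\}=\{y_i,y_j\}=0$, where $x_1,x_2$ are the standard coordinates on $X$ and $y_1,y_2$ the dual coordinates on $X^*$. $\mathsf{HP}_0(\mathcal{O}_V^G,\mathcal{O}_V):=\mathcal{O}_V/\{\mathcal{O}_V^G,\mathcal{O}_V\}$ (quotient by the linear span of brackets). $\mathcal{D}_X$ is the algebra of polynomial differential operators on $X$, with the additive (Bernstein) filtration in which linear coordinates and their derivations both have degree $1$, so $\mathrm{gr}\,\mathcal{D}_X=\mathcal{O}_V$. $\mathsf{HH}_0(\mathcal{D}_X^G,\mathcal{D}_X):=\mathcal{D}_X/[\mathcal{D}_X^G,\mathcal{D}_X]$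 with the induced filtration. There is a canonical graded surjection $\mathsf{HP}_0(\mathcal{O}_V^G,\mathcal{O}_V)\twoheadrightarrow\mathrm{gr}\,\mathsf{HH}_0(\mathcal{D}_X^G,\mathcal{D}_X)$; ''$\cong$'' means that it is an isomorphism. *)

(* Defs.v *)
From HB Require Import structures.
From mathcomp Require Import all_boot all_order all_algebra.
From mathcomp Require Import mpoly.
From mathcomp Require Import generic_quotient ring_quotient.
From mathcomp Require Import boolp classical_sets functions.
From mathcomp Require Import reals trigo.
From mathcomp Require Import complex.

Set Implicit Arguments.
Unset Strict Implicit.
Unset Printing Implicit Defensive.

Import GRing.Theory.

Local Open Scope ring_scope.
Local Open Scope quotient_scope.

Section Subspaces.
Context (K : pzRingType).

Definition span (V : lmodType K) (S : set V) : {pred V} := fun v =>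
  `[< forall U : set V, U 0 ->
        (forall a u w, U u -> U w -> U (a *: u + w)) ->
        (forall u, S u -> U u) -> U v >].

Fact span_submod_closed (V : lmodType K) (S : set V) : submod_closed (span S).
Proof.
split=> [|a u w /asboolP Su /asboolP Sw]; apply/asboolP => U U0 UL SU //.
by apply: (UL); [apply: Su | apply: Sw].
Qed.
HB.instance Definition _ (V : lmodType K) (S : set V) :=
  GRing.isSubmodClosed.Build K V (span S)
    (span_submod_closed S).

Lemma sub_span (V : lmodType K) (S : set V) v : S v -> v \in span S.
Proof. by move=> Sv; apply/asboolP => U _ _; apply. Qed.

Definition image_sub (V W : lmodType K) (f : {linear V -> W})
  (U : submodClosed V) : {pred W} := fun w => `[< exists2 v, v \in U & w = f v >].

Fact image_submod_closed (V W : lmodType K) (f : {linear V -> W})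
  (U : submodClosed V) : submod_closed (image_sub f U).
Proof.
split=> [|a w w' /asboolP[v Uv ->] /asboolP[v' Uv' ->]]; apply/asboolP.
  by exists 0; rewrite ?rpred0 ?raddf0.
by exists (a *: v + v'); rewrite ?linearP// rpredD// rpredZ.
Qed.
HB.instance Definition _ (V W : lmodType K) (f : {linear V -> W})
    (U : submodClosed V) :=
  GRing.isSubmodClosed.Build K W (image_sub f U)
    (image_submod_closed f U).

Lemma mem_image_sub (V W : lmodType K) (f : {linear V -> W})
  (U : submodClosed V) v : v \in U -> f v \in image_sub f U.
Proof. by move=> Uv; apply/asboolP; exists v. Qed.

Definition preimage_sub (V W : lmodType K) (f : {linear V -> W})
  (U : submodClosed W) : {pred V} := fun v => f v \in U.

Fact preimage_submod_closed (V W : lmodType K) (f : {linear V -> W})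
  (U : submodClosed W) : submod_closed (preimage_sub f U).
Proof.
have E v : (v \in preimage_sub f U) = (f v \in U) by [].
split=> [|a v v']; rewrite !E ?raddf0 ?rpred0// => Uv Uv'.
by rewrite linearP rpredD// rpredZ.
Qed.
HB.instance Definition _ (V W : lmodType K) (f : {linear V -> W})
    (U : submodClosed W) :=
  GRing.isSubmodClosed.Build K V (preimage_sub f U)
    (preimage_submod_closed f U).

Section SubType.
Context (V : lmodType K) (U : submodClosed V).

Record submod := Submod { submod_val : V; _ : submod_val \in U }.

HB.instance Definition _ := [isSub for submod_val].
HB.instance Definition _ := [Choice of submod by <:].
HB.instance Definition _ := [SubChoice_isSubLmodule of submod by <:].

Fact submod_val_is_linear : linear submod_val.
Proof. by []. Qed.
HB.instance Definition _ :=
  GRing.isLinear.Build K submod V _ submod_val submod_val_is_linear.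

End SubType.

Section Quotient.
Context (V : lmodType K) (U : submodClosed V).

(* [submodClosed] does not inherit from the [zmodClosed] that [Quotient.quot]
   expects. *)
Definition zsub : {pred V} := U.
HB.instance Definition _ :=
  GRing.isZmodClosed.Build V zsub (GRing.submod_closedB (submodClosedP U)).

Definition quotmod : Type := Quotient.quot zsub.
HB.instance Definition _ := GRing.Zmodule.on quotmod.

Definition qproj : V -> quotmod := \pi_(Quotient.quot zsub).

Lemma qprojP v w : qproj v = qproj w <-> v - w \in U.
Proof.
change (v - w \in U) with (v - w \in zsub).
by rewrite Quotient.idealrBE; split=> vw; apply/eqP.
Qed.

Fact qproj_is_zmod_morphism : zmod_morphism qproj.
Proof. by move=> v w; rewrite /qproj raddfB. Qed.
HB.instance Definition _ :=
  GRing.isZmodMorphism.Build V quotmod qproj qproj_is_zmod_morphism.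

Definition quot_repr (q : quotmod) : V := repr (q : Quotient.quot zsub).
Lemma quot_reprK : cancel quot_repr qproj.
Proof. by move=> q; apply: reprK. Qed.

Definition quot_scale (a : K) (q : quotmod) : quotmod := qproj (a *: quot_repr q).

Lemma quot_scaleE a v : quot_scale a (qproj v) = qproj (a *: v).
Proof.
by apply/qprojP; rewrite -scalerBr rpredZ//; apply/qprojP; rewrite quot_reprK.
Qed.

Fact quot_scalerA a b q : quot_scale a (quot_scale b q) = quot_scale (a * b) q.
Proof. by rewrite -[q]quot_reprK !quot_scaleE scalerA. Qed.
Fact quot_scale1r : left_id 1 quot_scale.
Proof. by move=> q; rewrite -[q]quot_reprK !quot_scaleE scale1r. Qed.
Fact quot_scalerDr : right_distributive quot_scale +%R.
Proof.
move=> a p q; rewrite -[p]quot_reprK -[q]quot_reprK.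
by rewrite -raddfD !quot_scaleE scalerDr raddfD.
Qed.
Fact quot_scalerDl q : {morph quot_scale^~ q : a b / a + b}.
Proof.
by move=> a b; rewrite -[q]quot_reprK !quot_scaleE scalerDl raddfD.
Qed.
HB.instance Definition _ := GRing.Zmodule_isLmodule.Build K quotmod
  quot_scalerA quot_scale1r quot_scalerDr quot_scalerDl.

Fact qproj_is_scalable : scalable qproj.
Proof. by move=> a v; rewrite -quot_scaleE. Qed.
HB.instance Definition _ :=
  GRing.isScalable.Build K V quotmod _ qproj qproj_is_scalable.

End Quotient.

Section DirectSum.
Context (W : nat -> lmodType K).

Record dsum := DSum {
  dsum_val :> forall k, W k;
  _ : `[< exists N : nat, forall k, (N <= k)%N -> dsum_val k = 0 >] }.

HB.instance Definition _ := [isSub for dsum_val].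
HB.instance Definition _ := gen_eqMixin dsum.
HB.instance Definition _ := gen_choiceMixin dsum.

Lemma dsumP (u w : dsum) : (forall k, u k = w k) <-> u = w.
Proof.
split=> [uw|-> //]; apply: val_inj.
exact: functional_extensionality_dep.
Qed.

Lemma dsum_fin (u : dsum) : exists N, forall k, (N <= k)%N -> u k = 0.
Proof. by case: u => u Pu; apply/asboolP. Qed.

Fact dsum0_subproof :
  `[< exists N : nat, forall k, (N <= k)%N -> 0 = 0 :> W k >].
Proof. by apply/asboolP; exists 0%N. Qed.
Definition dsum0 : dsum := DSum dsum0_subproof.

Fact dsum_opp_subproof (u : dsum) :
  `[< exists N : nat, forall k, (N <= k)%N -> - u k = 0 >].
Proof.
apply/asboolP; have [N uN] := dsum_fin u; exists N => k /uN ->.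
by rewrite oppr0.
Qed.
Definition dsum_opp u : dsum := DSum (dsum_opp_subproof u).

Fact dsum_add_subproof (u w : dsum) :
  `[< exists N : nat, forall k, (N <= k)%N -> u k + w k = 0 >].
Proof.
apply/asboolP; have [N uN] := dsum_fin u; have [M wM] := dsum_fin w.
by exists (maxn N M) => k; rewrite geq_max => /andP[/uN-> /wM->]; rewrite addr0.
Qed.
Definition dsum_add u w : dsum := DSum (dsum_add_subproof u w).

Fact dsum_scale_subproof (a : K) (u : dsum) :
  `[< exists N : nat, forall k, (N <= k)%N -> a *: u k = 0 >].
Proof.
apply/asboolP; have [N uN] := dsum_fin u; exists N => k /uN ->.
by rewrite scaler0.
Qed.
Definition dsum_scale a u : dsum := DSum (dsum_scale_subproof a u).

Fact dsum_addA : associative dsum_add.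
Proof. by move=> u v w; apply/dsumP => k; apply: addrA. Qed.
Fact dsum_addC : commutative dsum_add.
Proof. by move=> u v; apply/dsumP => k; apply: addrC. Qed.
Fact dsum_add0 : left_id dsum0 dsum_add.
Proof. by move=> u; apply/dsumP => k; apply: add0r. Qed.
Fact dsum_addN : left_inverse dsum0 dsum_opp dsum_add.
Proof. by move=> u; apply/dsumP => k; apply: addNr. Qed.
HB.instance Definition _ :=
  GRing.isZmodule.Build dsum dsum_addA dsum_addC dsum_add0 dsum_addN.

Fact dsum_scalerA a b u : dsum_scale a (dsum_scale b u) = dsum_scale (a * b) u.
Proof. by apply/dsumP => k; apply: scalerA. Qed.
Fact dsum_scale1r : left_id 1 dsum_scale.
Proof. by move=> u; apply/dsumP => k; apply: scale1r. Qed.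
Fact dsum_scalerDr : right_distributive dsum_scale +%R.
Proof. by move=> a u v; apply/dsumP => k; apply: scalerDr. Qed.
Fact dsum_scalerDl u : {morph dsum_scale^~ u : a b / a + b}.
Proof. by move=> a b; apply/dsumP => k; apply: scalerDl. Qed.
HB.instance Definition _ := GRing.Zmodule_isLmodule.Build K dsum
  dsum_scalerA dsum_scale1r dsum_scalerDr dsum_scalerDl.

Fact dsum_inj_subproof k (w : W k) :
  `[< exists N : nat, forall l, (N <= l)%N ->
        dfwith (fun l => 0 : W l) w l = 0 >].
Proof.
apply/asboolP; exists k.+1 => l kl; rewrite dfwith_out//.
by rewrite neq_ltn kl.
Qed.
Definition dsum_inj k (w : W k) : dsum := DSum (dsum_inj_subproof w).

End DirectSum.

(* [F k] is the piece of filtration degree < k (so that F 0 plays the role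
   of F_{-1}), as with [msize] for multivariate polynomials. *)
Definition gr_piece (V : lmodType K) (F : nat -> submodClosed V) (k : nat) :
    lmodType K :=
  quotmod (preimage_sub (@submod_val V (F k.+1)) (F k)).

Definition gr (V : lmodType K) (F : nat -> submodClosed V) : lmodType K :=
  dsum (gr_piece F).

Definition gr_class (V : lmodType K) (F : nat -> submodClosed V) (k : nat)
    (v : V) (Fv : v \in F k.+1) : gr F :=
  @dsum_inj (gr_piece F) k (qproj _ (Submod Fv)).

Definition is_basis (V : lmodType K) (n : nat) (b : 'I_n -> V) : Prop :=
  (forall c : 'I_n -> K, \sum_i c i *: b i = 0 -> forall i, c i = 0) /\
  (forall v : V, exists c : 'I_n -> K, v = \sum_i c i *: b i).

End Subspaces.

Section Poisson.
Context (K : fieldType) (n : nat).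
Local Notation O_V := {mpoly K[n + n]}.

Definition coord_x (i : 'I_n) : O_V := 'X_(lshift n i).
Definition coord_y (i : 'I_n) : O_V := 'X_(rshift n i).

Definition pbracket (f g : O_V) : O_V :=
  \sum_(i < n) (f^`M(lshift n i) * g^`M(rshift n i)
                - f^`M(rshift n i) * g^`M(lshift n i)).

End Poisson.

Section Weyl.
Context (K : fieldType) (n : nat).
Local Notation O_X := {mpoly K[n]}.

Inductive diffop : (O_X -> O_X) -> Prop :=
| diffop_id : diffop id
| diffop_coord (i : 'I_n) : diffop (fun p => 'X_i * p)
| diffop_deriv (i : 'I_n) : diffop (fun p => p^`M(i))
| diffop_lin (a : K) P Q : diffop P -> diffop Q -> diffop (a *: P + Q)
| diffop_comp P Q : diffop P -> diffop Q -> diffop (P \o Q).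

Definition diffop_pred : {pred O_X -> O_X} := fun P => `[< diffop P >].

Fact diffop_submod_closed : submod_closed diffop_pred.
Proof.
split=> [|a P Q /asboolP dP /asboolP dQ]; apply/asboolP; last exact: diffop_lin.
rewrite -(addNr (id : O_X -> O_X)) -scaleN1r.
exact: diffop_lin diffop_id diffop_id.
Qed.
HB.instance Definition _ :=
  GRing.isSubmodClosed.Build K (O_X -> O_X) diffop_pred diffop_submod_closed.

Record weyl := Weyl { weyl_fun :> O_X -> O_X; _ : weyl_fun \in diffop_pred }.
HB.instance Definition _ := [isSub for weyl_fun].
HB.instance Definition _ := [Choice of weyl by <:].
HB.instance Definition _ := [SubChoice_isSubLmodule of weyl by <:].

Lemma weyl_diffop (P : weyl) : diffop P.
Proof. by case: P => P dP; apply/asboolP. Qed.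

Lemma diffop_linear P : diffop P -> linear P.
Proof.
elim=> [|i|i|a P1 Q _ lP _ lQ|P1 Q _ lP _ lQ] b p q //=.
- by rewrite mulrDr -scalerAr.
- exact: linearP.
- have E r : (a *: P1 + Q) r = a *: P1 r + Q r by [].
  by rewrite !E lP lQ !scalerDr !scalerA [a * b]mulrC addrACA.
- by rewrite lQ lP.
Qed.

Definition weyl_one : weyl := Weyl (asboolT diffop_id).
Definition weyl_mul (P Q : weyl) : weyl :=
  Weyl (asboolT (diffop_comp (weyl_diffop P) (weyl_diffop Q))).

Lemma weylP (P Q : weyl) : (forall p, P p = Q p) <-> P = Q.
Proof. by split=> [PQ|-> //]; apply: val_inj; apply/funext. Qed.

Fact weyl_mulA : associative weyl_mul.
Proof. by move=> P Q S; apply/weylP. Qed.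
Fact weyl_mul1l : left_id weyl_one weyl_mul.
Proof. by move=> P; apply/weylP. Qed.
Fact weyl_mul1r : right_id weyl_one weyl_mul.
Proof. by move=> P; apply/weylP. Qed.
Fact weyl_mulDl : left_distributive weyl_mul +%R.
Proof. by move=> P Q S; apply/weylP. Qed.
Fact weyl_mulDr : right_distributive weyl_mul +%R.
Proof.
move=> P Q S; apply/weylP => p /=.
by have := diffop_linear (weyl_diffop P) 1 (Q p) (S p); rewrite !scale1r.
Qed.
Fact weyl_oner_neq0 : weyl_one != 0.
Proof.
apply/eqP => /weylP /(_ 1) /= /eqP; apply/negP; exact: oner_neq0.
Qed.
HB.instance Definition _ := GRing.Zmodule_isNzRing.Build weyl
  weyl_mulA weyl_mul1l weyl_mul1r weyl_mulDl weyl_mulDr weyl_oner_neq0.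

Fact weyl_scalerAl (a : K) (P Q : weyl) : a *: (P * Q) = (a *: P) * Q.
Proof. exact/weylP. Qed.
HB.instance Definition _ :=
  GRing.Lmodule_isLalgebra.Build K weyl weyl_scalerAl.

Fact weyl_scalerAr (a : K) (P Q : weyl) : a *: (P * Q) = P * (a *: Q).
Proof.
apply/weylP => p /=; have := diffop_linear (weyl_diffop P) a (Q p) 0.
have /= := diffop_linear (weyl_diffop P) (-1) 0 0.
rewrite scaler0 addr0 scaleN1r addNr => ->; rewrite !addr0 => ->.
by [].
Qed.
HB.instance Definition _ :=
  GRing.Lalgebra_isAlgebra.Build K weyl weyl_scalerAr.

Definition weyl_x (i : 'I_n) : weyl := Weyl (asboolT (diffop_coord i)).
Definition weyl_d (i : 'I_n) : weyl := Weyl (asboolT (diffop_deriv i)).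

(* Normal ordering, x^a y^b |-> x^a d^b.  [mmap] multiplies the images of the
   variables in increasing order of their indices, so that all the x_i stand
   to the left of all the d_i. *)
Definition normal_order : {mpoly K[n + n]} -> weyl :=
  mmap (in_alg weyl)
    (fun i => match fintype.split i with inl j => weyl_x j | inr j => weyl_d j end).

(* Operators of Bernstein degree < k. *)
Definition bernstein (k : nat) : submodClosed weyl :=
  span [set normal_order 'X_[m] | m in [set m | (mdeg m < k)%N]]%classic.

End Weyl.

Section Actions.
Context (K : fieldType).

(* (A . f)(v) = f (A^-1 v), for column vectors v *)
Definition mpoly_act (k : nat) (A : 'M[K]_k) (f : {mpoly K[k]}) : {mpoly K[k]} :=
  f \mPo [tuple \sum_(j < k) invmx A i j *: 'X_j | i < k].

(* The embedding GL(X) -> Sp(X + X^* ), in the standard and dual bases. *)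
Definition gl_sp (n : nat) (A : 'M[K]_n) : 'M[K]_(n + n) :=
  block_mx A 0 0 (invmx A)^T.

Definition O_V_invariant (n : nat) (G : set 'M[K]_n) (f : {mpoly K[n + n]}) :=
  forall A, G A -> mpoly_act (gl_sp A) f = f.

Definition weyl_invariant (n : nat) (G : set 'M[K]_n) (P : weyl K n) :=
  forall A, G A -> mpoly_act A \o P \o mpoly_act (invmx A) = P.

End Actions.

Section HomologyZero.
Context (K : fieldType) (n : nat) (G : set 'M[K]_n).

Definition pbrackets : submodClosed {mpoly K[n + n]} :=
  span [set h | exists f g, O_V_invariant G f /\ h = pbracket f g]%classic.

Definition HP0 : lmodType K := quotmod pbrackets.

Definition commutators : submodClosed (weyl K n) :=
  span [set S | exists P Q, weyl_invariant G P /\ S = P * Q - Q * P]%classic.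

Definition HH0 : lmodType K := quotmod commutators.

Definition filtHH0 (k : nat) : submodClosed HH0 :=
  image_sub (@qproj _ _ commutators) (bernstein K n k).

Definition grHH0 : lmodType K := gr filtHH0.

Fact normal_order_filt k (f : dhomog (n + n) K k) :
  qproj commutators (normal_order f) \in filtHH0 k.+1.
Proof.
apply: mem_image_sub; rewrite /normal_order /mmap big_seq rpred_sum// => m fm.
rewrite -scalerAl mul1r rpredZ//; apply: sub_span; exists m.
  by rewrite /= ltnS (dhomogP _ _ _ (dhomog_is_dhomog f) m fm).
by rewrite /normal_order mmapX.
Qed.

(* gr D_X is identified with O_V by taking y_i as the symbol of d_i, so f is the
   symbol of [normal_order f].  With {x_i, y_j} = delta_ij the symbol of a
   commutator is then minus the bracket of the symbols; the sign affects neither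
   span of brackets. *)
Definition symbol_class k (f : dhomog (n + n) K k) : grHH0 :=
  gr_class (normal_order_filt f).

End HomologyZero.

Section G_m_m_2.
Context (R : realType).

Definition expi (t : R) : R[i] := (cos t +i* sin t)%C.

Definition rot_gen (m : nat) : 'M[R[i]]_2 :=
  \matrix_(i, j) (if i != j then 0
                  else expi ((if i == 0 then 1 else -1) * (2 * pi / m%:R))).

Definition swap_gen : 'M[R[i]]_2 := \matrix_(i, j) (i != j)%:R.

Inductive Gmm2 (m : nat) : set 'M[R[i]]_2 :=
| Gmm2_rot : Gmm2 m (rot_gen m)
| Gmm2_swap : Gmm2 m swap_gen
| Gmm2_one : Gmm2 m 1%:M
| Gmm2_mul A B : Gmm2 m A -> Gmm2 m B -> Gmm2 m (A *m B)
| Gmm2_inv A : Gmm2 m A -> Gmm2 m (invmx A).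

Definition HP0_generator (a : nat) : {mpoly R[i][2 + 2]} :=
  coord_x _ 0 ^+ a * coord_y _ 0 ^+ a
  + (-1) ^+ a * (coord_x _ 1 ^+ a * coord_y _ 1 ^+ a).

End G_m_m_2.

(* Main.v *)
(* The invariants x1 x2 and x1 y1 + x2 y2 already bring every polynomial, modulo
   brackets, to a combination of the elements b_a = x1^a y1^a + (-1)^a x2^a y2^a,
   and bracketing with x1^m + x2^m kills b_a for a >= m - 1.  Conversely, for
   each nontrivial rotation g = diag(q^-1, q) of G there is a g-twisted trace on
   D_X, i.e. a regularization of P |-> tr(P g) on C[x1, x2]; it vanishes on
   [D_X^G, D_X].  Up to a scalar it sends the normal ordering of
   x1^a x2^b y1^a y2^b to a! b! (u - 1)^a (-u)^b, where u = 1 / (1 - q), and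
   kills all other normally ordered monomials.  Hence a relation
   c b_a = (lower order terms) + (commutators) gives a polynomial in u of degree
   at most a <= m - 2, with leading coefficient 2 a! c, having the m - 1 distinct
   roots 1 / (1 - q), so c = 0.  This shows at once that the b_a with a <= m - 2
   are independent in HP_0 and that the surjection onto gr HH_0 is injective. *)
Require Import Defs.
From HB Require Import structures.
From mathcomp Require Import all_boot all_order all_algebra.
From mathcomp Require Import mpoly ssrcomplements.
From mathcomp Require Import boolp classical_sets.
From mathcomp Require Import reals trigo.
From mathcomp Require Import complex.
From mathcomp Require Import ring zify.

Set Implicit Arguments.
Unset Strict Implicit.
Unset Printing Implicit Defensive.

Import Order.TTheory GRing.Theory Num.Theory.

Local Open Scope ring_scope.

(** * Normal ordering *)

Lemma mpoly_ind_monom (K : fieldType) k (P : {mpoly K[k]} -> Prop) :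
  (forall a f g, P f -> P g -> P (a *: f + g)) -> (forall m, P 'X_[m]) ->
  forall f, P f.
Proof.
move=> PL PM f; rewrite [f]mpolyE; elim/big_rec: _ => [|m g _ Pg]; last exact: PL.
(* The empty sum is reached as [-1 *: 1 + 1], so that closure under [a *: f + g] is enough. *)
by rewrite -(addNr 1) -scaleN1r -mpolyX0; apply: PL.
Qed.

Lemma mnm_ind k (Q : 'X_{1..k} -> Prop) :
  Q 0%MM -> (forall i m, Q m -> Q (U_(i) + m)%MM) -> forall m, Q m.
Proof.
move=> Q0 QU m; elim: {m}(mdeg m) {-2}m (erefl (mdeg m)) => [|d IH] m.
  by move/eqP; rewrite mdeg_eq0 => /eqP->.
move=> dm; have [i mi] : exists i, (m i != 0)%N.
  apply/existsP; apply: contraPT dm => /existsPn m0.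
  by rewrite mdegE big1// => i _; apply/eqP; rewrite -[_ == _]negbK m0.
have mU : (U_(i) <= m)%MM.
  by apply/mnm_lepP => j; rewrite mnm1E; case: eqP => // <-; rewrite lt0n.
rewrite -(submK mU) addmC; apply: QU; apply: IH.
by rewrite -[RHS]/(d.+1.-1) -dm -[in RHS](submK mU) mdegD mdeg1 addn1.
Qed.

Lemma mpoly_ind_mulX (K : fieldType) k (P : {mpoly K[k]} -> Prop) :
  (forall a f g, P f -> P g -> P (a *: f + g)) -> P 1 ->
  (forall i f, P f -> P ('X_i * f)) -> forall f, P f.
Proof.
move=> PL P1 PX f; elim/mpoly_ind_monom: f => [//|m].
elim/mnm_ind: m => [|i m Pm]; first by rewrite mpolyX0.
by rewrite mpolyXD; apply: PX.
Qed.

Lemma mderivXU (K : fieldType) k (i j : 'I_k) :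
  ('X_j : {mpoly K[k]})^`M(i) = (i == j)%:R.
Proof.
rewrite mderivX mnm1E eq_sym; case: eqP => [->|_]; last by rewrite scale0r.
rewrite (_ : U_(j) - U_(j) = 0)%MM ?mpolyX0 ?scale1r//.
by apply/mnmP => l; rewrite mnmBE subnn mnm0E.
Qed.

Section NormalOrder.
Context (K : fieldType) (n : nat).
Local Notation O_V := {mpoly K[n + n]}.
Local Notation W := (weyl K n).
Local Notation no := (@normal_order K n).
Local Notation x := (@coord_x K n).
Local Notation y := (@coord_y K n).
Local Notation dx i f := (mderiv (lshift n i) f).
Local Notation dy i f := (mderiv (rshift n i) f).
Local Notation X := (@weyl_x K n).
Local Notation D := (@weyl_d K n).

Lemma mpoly_ind_xy (P : O_V -> Prop) :
  (forall a f g, P f -> P g -> P (a *: f + g)) -> P 1 ->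
  (forall i f, P f -> P (x i * f)) -> (forall i f, P f -> P (y i * f)) ->
  forall f, P f.
Proof.
move=> PL P1 Px Py; apply: mpoly_ind_mulX => // i f.
by rewrite -(splitK i); case: split => j /= ?; [apply: Px | apply: Py].
Qed.

Fact normal_order_is_linear : linear no.
Proof.
move=> a f g; rewrite /normal_order mmapD; congr (_ + _).
by rewrite mmapZ [LHS]/= -scalerAl mul1r.
Qed.
HB.instance Definition _ :=
  GRing.isLinear.Build K O_V W _ no normal_order_is_linear.

Lemma normal_order0 : no 0 = 0. Proof. exact: linear0. Qed.
Lemma normal_orderD f g : no (f + g) = no f + no g. Proof. exact: linearD. Qed.
Lemma normal_orderB f g : no (f - g) = no f - no g. Proof. exact: linearB. Qed.
Lemma normal_orderZ a f : no (a *: f) = a *: no f. Proof. exact: linearZ. Qed.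
Lemma normal_order1 : no 1 = 1.
Proof. by rewrite /normal_order -mpolyX0 mmapX mmap11. Qed.

Lemma weyl_1E p : (1 : W) p = p. Proof. by []. Qed.
Lemma weyl_mulE (P Q : W) p : (P * Q) p = P (Q p). Proof. by []. Qed.
Lemma weyl_addE (P Q : W) p : (P + Q) p = P p + Q p. Proof. by []. Qed.
Lemma weyl_scaleE a (P : W) p : (a *: P) p = a *: P p. Proof. by []. Qed.

Lemma weyl_xxC i j : X i * X j = X j * X i.
Proof. by apply/weylP => p; rewrite !weyl_mulE /= mulrCA. Qed.
Lemma weyl_ddC i j : D i * D j = D j * D i.
Proof. by apply/weylP => p; rewrite !weyl_mulE /= mderiv_comm. Qed.
Lemma weyl_dx i j : D i * X j = X j * D i + (i == j)%:R.
Proof.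
apply/weylP => p; rewrite weyl_addE !weyl_mulE /= mderivM mderivXU.
rewrite addrC; congr (_ + _); case: eqP => _.
  by rewrite mul1r.
by rewrite mul0r.
Qed.

Lemma comm_prodXU (Z : nzRingType) k (h : 'I_k -> Z) :
  (forall i j, GRing.comm (h i) (h j)) -> forall i (m : 'X_{1..k}),
  \prod_j h j ^+ (U_(i) + m)%MM j = h i * \prod_j h j ^+ m j.
Proof.
move=> hC i m; 
have <- : \prod_j h j ^+ U_(i)%MM j = h i by rewrite -[RHS]mmap1U.
rewrite -prodrM_comm => [|j l _ _]; last exact/commrX/commr_sym/commrX.
by apply: eq_bigr => j _; rewrite mnmDE exprD.
Qed.

Let normal_orderX (m : 'X_{1..n + n}) : no 'X_[m] =
  \prod_j X j ^+ [multinom m (lshift n j) | j < n] j *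
  \prod_j D j ^+ [multinom m (rshift n j) | j < n] j.
Proof.
rewrite /normal_order mmapX /mmap1 big_split_ord /=.
by congr (_ * _); apply: eq_bigr => j _;
  rewrite mnmE ?(unsplitK (inl j)) ?(unsplitK (inr j)).
Qed.

(** In a normally ordered monomial the [X j] stand on the left and the [D j] on the right, so an
    [x i] enters on the left, and a [y i] on the right, without correction terms. *)
Lemma normal_order_x i f : no (x i * f) = X i * no f.
Proof.
elim/mpoly_ind_monom: f => [a p q IHp IHq|m].
  by rewrite mulrDr -scalerAr !normal_order_is_linear IHp IHq mulrDr scalerAr.
rewrite -mpolyXD !normal_orderX mulrA -comm_prodXU; last exact: weyl_xxC.
congr (_ * _); apply: eq_bigr => j _; rewrite !(mnmDE, mnm1E, mnmE) ?eq_lshift//.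
by rewrite eq_lrshift.
Qed.

Lemma normal_order_y i f : no (y i * f) = no f * D i.
Proof.
elim/mpoly_ind_monom: f => [a p q IHp IHq|m].
  by rewrite mulrDr -scalerAr !normal_order_is_linear IHp IHq mulrDl scalerAl.
rewrite -mpolyXD !normal_orderX -mulrA.
have dC (r : 'X_{1..n}) : GRing.comm (D i) (\prod_j D j ^+ r j).
  by apply: commr_prod => j _; apply/commrX/weyl_ddC.
rewrite -dC -comm_prodXU; last exact: weyl_ddC.
congr (_ * _); apply: eq_bigr => j _; rewrite !(mnmDE, mnm1E, mnmE) ?eq_rshift//.
by rewrite eq_rlshift.
Qed.

Lemma dx_x i j : dx i (x j) = (i == j)%:R.
Proof. by rewrite mderivXU eq_lshift. Qed.
Lemma dx_y i j : dx i (y j) = 0.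
Proof. by rewrite mderivXU eq_lrshift. Qed.
Lemma dy_x i j : dy i (x j) = 0.
Proof. by rewrite mderivXU eq_rlshift. Qed.
Lemma dy_y i j : dy i (y j) = (i == j)%:R.
Proof. by rewrite mderivXU eq_rshift. Qed.

Lemma normal_order_nat b f : no (b%:R * f) = b%:R * no f.
Proof. by rewrite !mulr_natl; apply: raddfMn. Qed.

(** Commuting with [D i] is a derivation that kills each [D j] and sends [X j] to a Kronecker delta;
    on symbols it is exactly a partial derivative, with no lower order terms. *)
Lemma weyl_comm_d i f : D i * no f - no f * D i = no (dx i f).
Proof.
elim/mpoly_ind_xy: f => [a f g IHf IHg||j f IH|j f IH].
- rewrite mderivD mderivZ !normal_order_is_linear -IHf -IHg.
  by rewrite mulrDr mulrDl -scalerAl -scalerAr opprD addrACA -scalerBr.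
- by rewrite normal_order1 mulr1 mul1r subrr mderivC linear0.
- rewrite mderivM dx_x linearD /= normal_order_nat !normal_order_x -IH.
  by rewrite mulrA weyl_dx mulrDl mulrBr !mulrA [X in X - _ = _]addrC -addrA.
- rewrite mderivM dx_y mul0r add0r !normal_order_y -IH mulrBl -!mulrA.
  by rewrite (weyl_ddC i).
Qed.

Lemma weyl_comm_x i f : no f * X i - X i * no f = no (dy i f).
Proof.
elim/mpoly_ind_xy: f => [a f g IHf IHg||j f IH|j f IH].
- rewrite mderivD mderivZ !normal_order_is_linear -IHf -IHg.
  by rewrite mulrDr mulrDl -scalerAl -scalerAr opprD addrACA -scalerBr.
- by rewrite normal_order1 mulr1 mul1r subrr mderivC linear0.
- rewrite mderivM dy_x mul0r add0r !normal_order_x -IH mulrBr !mulrA.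
  by rewrite (weyl_xxC i).
- rewrite mderivM dy_y linearD /= normal_order_nat !normal_order_y -IH.
  rewrite -mulrA weyl_dx mulrDr mulrBl !mulrA [X in X - _ = _]addrC -addrA.
  by rewrite mulr_natr mulr_natl eq_sym.
Qed.

Lemma weyl_mul_d i f : D i * no f = no (y i * f + dx i f).
Proof. by rewrite linearD /= -weyl_comm_d normal_order_y addrC subrK. Qed.

Lemma weyl_mul_x i f : no f * X i = no (x i * f + dy i f).
Proof. by rewrite linearD /= -weyl_comm_x normal_order_x addrC subrK. Qed.

(** A factor [x i] puts [X i] on the left and leaves no constant term; a factor [y i] puts [D i] on
    the right and kills the argument 1. *)
Lemma mcoeff0_normal_order f : (no f 1)@_0 = f@_0.
Proof.
elim/mpoly_ind_xy: f => [a f g IHf IHg||i f IH|i f IH].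
- by rewrite normal_order_is_linear weyl_addE weyl_scaleE !linearP /= IHf IHg.
- by rewrite normal_order1 weyl_1E !mcoeff1 !eqxx.
- rewrite normal_order_x weyl_mulE /= !rmorphM /= /coord_x !mcoeffX.
  by rewrite !mnm1_eq0 !mul0r.
- rewrite normal_order_y weyl_mulE /= mderivC rmorphM /= /coord_y mcoeffX.
  rewrite mnm1_eq0 mul0r; have /(_ (-1) 0 0) := diffop_linear (weyl_diffop (no f)).
  by rewrite scaler0 addr0 scaleN1r addNr => ->; rewrite mcoeff0.
Qed.

(** Commutators with [D i] and [X i] differentiate the symbol in every variable, so each coefficient
    can be brought down to the constant term; the integer factors that appear are nonzero in
    characteristic zero. *)
Lemma normal_order_inj : [pchar K] =i pred0 -> injective no.
Proof.
move=> K0 f g /eqP; rewrite -subr_eq0 -linearB /= => /eqP fg0.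
apply/eqP; rewrite -subr_eq0; apply/eqP/mpolyP => m; rewrite mcoeff0.
elim/mnm_ind: m (f - g) fg0 => {f g} [|i m IH] f f0.
  by rewrite -mcoeff0_normal_order f0 mcoeff0.
suff : (f^`M(i))@_m = 0.
  rewrite mcoeff_mderiv addmC => /eqP; rewrite -mulr_natr mulf_eq0.
  by rewrite ((pcharf0P K).1 K0) orbF => /eqP.
apply: IH; rewrite -(splitK i); case: split => j /=.
  by rewrite -weyl_comm_d f0 mulr0 mul0r subrr.
by rewrite -weyl_comm_x f0 mulr0 mul0r subrr.
Qed.

(** The generators in [u] are absorbed one at a time into the right factor, which changes when a
    [D i] crosses it; hence the induction on [u] with [v] arbitrary. *)
Lemma normal_order_mul u v : exists w, no u * no v = no w.
Proof.
elim/mpoly_ind_xy: u v => [a f g IHf IHg v||i f IH v|i f IH v].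
- have [wf fE] := IHf v; have [wg gE] := IHg v; exists (a *: wf + wg).
  by rewrite !normal_order_is_linear mulrDl -scalerAl fE gE.
- by move=> v; exists v; rewrite normal_order1 mul1r.
- by have [w wE] := IH v; exists (x i * w); rewrite !normal_order_x -mulrA wE.
- have [w wE] := IH (y i * v + dx i v); exists w.
  by rewrite normal_order_y -mulrA weyl_mul_d.
Qed.

Lemma normal_order_surj (P : W) : exists f, P = no f.
Proof.
suff : exists f, forall p, P p = no f p by case=> f /weylP; exists f.
elim: (weyl_diffop P) => [|i|i|a Q S _ [f fE] _ [g gE]|Q S _ [f fE] _ [g gE]].
- by exists 1 => p; rewrite normal_order1.
- by exists (x i) => p; rewrite -[x i]mulr1 normal_order_x normal_order1 mulr1.
- by exists (y i) => p; rewrite -[y i]mulr1 normal_order_y normal_order1 mul1r.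
- exists (a *: f + g) => p.
  by rewrite normal_order_is_linear weyl_addE weyl_scaleE -fE -gE.
- have [h hE] := normal_order_mul f g; exists h => p.
  by rewrite -hE weyl_mulE -gE -fE.
Qed.

Lemma msize_le_sum k (f : O_V) : (msize f <= k)%N ->
  f = \sum_(m <- msupp f | (mdeg m < k)%N) f@_m *: 'X_[m].
Proof.
move=> fk; rewrite {1}[f]mpolyE big_seq [in RHS]big_seq_cond.
apply: eq_bigl => m; case: (boolP (m \in msupp f)) => //= mf.
by rewrite (leq_trans (msize_mdeg_lt mf)).
Qed.

Lemma normal_order_bernstein k f : (msize f <= k)%N -> no f \in bernstein K n k.
Proof.
move=> /msize_le_sum ->; rewrite linear_sum rpred_sum// => m mk.
by rewrite linearZ rpredZ//; apply: Defs.sub_span; exists m.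
Qed.

Lemma bernsteinP k (P : W) :
  reflect (exists2 f, (msize f <= k)%N & P = no f) (P \in bernstein K n k).
Proof.
apply: (iffP idP) => [|[f fk ->]]; last exact: normal_order_bernstein.
move=> /asboolP/(_ (fun P => exists2 f, (msize f <= k)%N & P = no f)).
apply=> [|a _ _ [f fk ->] [g gk ->]|_ [m mk <-]].
- by exists 0; rewrite ?linear0// msize0.
- exists (a *: f + g); last by rewrite linearP.
  apply: leq_trans (msizeD_le _ _) _; rewrite geq_max gk andbT.
  exact: leq_trans (msizeZ_le _ _) fk.
- by exists 'X_[m]; rewrite // msizeX.
Qed.

Lemma bernsteinS k l (P : W) : (k <= l)%N ->
  P \in bernstein K n k -> P \in bernstein K n l.
Proof.
move=> kl /bernsteinP[f fk ->]; apply/bernsteinP; exists f => //.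
exact: leq_trans kl.
Qed.

Lemma msize_mderiv k (i : 'I_k) (f : {mpoly K[k]}) : (msize f^`M(i) <= (msize f).-1)%N.
Proof.
rewrite [leqLHS]msizeE; apply/bigmax_leqP_seq => m mf _.
rewrite mcoeff_msupp mcoeff_mderiv in mf.
have : (m + U_(i))%MM \in msupp f.
  by rewrite mcoeff_msupp; apply: contraNneq mf => ->; rewrite mul0rn.
by move/msize_mdeg_lt; rewrite mdegD mdeg1 addn1; case: (msize f).
Qed.

Lemma msize_mulXU k (i : 'I_k) (f : {mpoly K[k]}) :
  (msize ('X_i * f) <= (msize f).+1)%N.
Proof.
have [->|f0] := eqVneq f 0; first by rewrite mulr0 msize0.
by rewrite msizeM// -?msize_poly_eq0 msizeX mdeg1.
Qed.

(** The predecessor is truncated: for [k = 0] both sides concern only the zero operator. This spares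
    the inductions below any positivity condition on degrees. *)
Lemma bernstein_x i k (P : W) :
  P \in bernstein K n k.-1 -> X i * P \in bernstein K n k.
Proof.
move=> /bernsteinP[f fk ->]; rewrite -normal_order_x.
case: k fk => [|k] /= fk.
  have /eqP-> : f == 0 by rewrite -msize_poly_eq0 -leqn0.
  by rewrite mulr0 linear0 rpred0.
apply: normal_order_bernstein; apply: leq_trans (msize_mulXU _ _) _; exact: fk.
Qed.

Lemma bernstein_d i k (P : W) :
  P \in bernstein K n k.-1 -> P * D i \in bernstein K n k.
Proof.
move=> /bernsteinP[f fk ->]; rewrite -normal_order_y.
case: k fk => [|k] /= fk.
  have /eqP-> : f == 0 by rewrite -msize_poly_eq0 -leqn0.
  by rewrite mulr0 linear0 rpred0.
apply: normal_order_bernstein; apply: leq_trans (msize_mulXU _ _) _; exact: fk.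
Qed.

End NormalOrder.

(** * Leading terms of products and commutators *)

Section Symbols.
Context (K : fieldType) (n : nat).
Local Notation O_V := {mpoly K[n + n]}.
Local Notation W := (weyl K n).
Local Notation no := (@normal_order K n).
Local Notation x := (@coord_x K n).
Local Notation y := (@coord_y K n).
Local Notation dx i f := (mderiv (lshift n i) f).
Local Notation dy i f := (mderiv (rshift n i) f).
Local Notation X := (@weyl_x K n).
Local Notation D := (@weyl_d K n).

Lemma mnm_ind_xy (Q : 'X_{1..n + n} -> Prop) :
  Q 0%MM -> (forall i m, Q m -> Q (U_(lshift n i) + m)%MM) ->
  (forall i m, Q m -> Q (U_(rshift n i) + m)%MM) -> forall m, Q m.
Proof.
move=> Q0 Ql Qr m; elim/mnm_ind: m => // i m.
by rewrite -(splitK i); case: split => j /= ?; [apply: Ql | apply: Qr].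
Qed.

Lemma msize_mulX k (m : 'X_{1..k}) (f : {mpoly K[k]}) :
  (msize ('X_[m] * f) <= mdeg m + msize f)%N.
Proof.
have [->|f0] := eqVneq f 0; first by rewrite mulr0 msize0.
by rewrite msizeM// -?msize_poly_eq0 msizeX.
Qed.

(** Sizes exceed degrees by one, so [v] has degree at most [l] and the error has degree below
    [mdeg m + l]. Errors arise only when some [D i] crosses [v], and they involve the derivative
    [dx i v], which has lower degree. *)
Lemma normal_orderM_mnm m v l : (msize v <= l.+1)%N ->
  no 'X_[m] * no v - no ('X_[m] * v) \in bernstein K n (mdeg m + l).
Proof.
elim/mnm_ind_xy: m v l => [v l vl|i m IH v l vl|i m IH v l vl].
- by rewrite mpolyX0 normal_order1 !mul1r subrr rpred0.
- rewrite mpolyXD -mulrA -!/(x i) !normal_order_x -mulrA -mulrBr.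
  by apply: bernstein_x; rewrite mdegD mdeg1; apply: IH.
- rewrite mpolyXD -mulrA -!/(y i) normal_order_y -[_ * D i * _]mulrA weyl_mul_d.
  rewrite mulrCA.
  (* The induction hypothesis is applied to the exact symbol [y i * v + dx i v] of [D i * no v], of
     degree at most [l + 1]; the term left over is of low degree by itself. *)
  have -> : 'X_[m] * (y i * v) = 'X_[m] * (y i * v + dx i v) - 'X_[m] * dx i v.
    by rewrite mulrDr addrK.
  rewrite normal_orderB opprB addrCA addrC; apply: rpredD.
    rewrite mdegD mdeg1 [(1 + _)%N]addnC -addnA add1n; apply: IH.
    apply: leq_trans (msizeD_le _ _) _; rewrite geq_max.
    rewrite (leq_trans (msize_mulXU _ _))//=.
    by rewrite (leq_trans (msize_mderiv _ _))// (leq_trans (leq_pred _))// ltnW.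
  apply: normal_order_bernstein; apply: leq_trans (msize_mulX _ _) _.
  have := msize_mderiv (lshift n i) v; rewrite mdegD mdeg1; lia.
Qed.

Lemma normal_orderM u v k l : (msize u <= k.+1)%N -> (msize v <= l.+1)%N ->
  no u * no v - no (u * v) \in bernstein K n (k + l).
Proof.
move=> uk vl; rewrite (msize_le_sum uk).
elim/big_ind: _ => [|f g Bf Bg|m mk].
- by rewrite normal_order0 !mul0r normal_order0 subrr rpred0.
- by rewrite normal_orderD !mulrDl normal_orderD opprD addrACA rpredD.
- rewrite -scalerAl !normal_orderZ -scalerAl -scalerBr rpredZ//.
  by apply: bernsteinS (normal_orderM_mnm _ vl); rewrite leq_add2r -ltnS.
Qed.

Lemma pbracketC (f g : O_V) : pbracket f g = - pbracket g f.
Proof. by rewrite /pbracket -sumrN; apply: eq_bigr => i _; ring. Qed.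

Lemma pbracketDl (f g h : O_V) : pbracket (f + g) h = pbracket f h + pbracket g h.
Proof.
rewrite /pbracket -big_split; apply: eq_bigr => i _ /=.
by rewrite !mderivD; ring.
Qed.

Lemma pbracketZl a (f g : O_V) : pbracket (a *: f) g = a *: pbracket f g.
Proof.
rewrite /pbracket scaler_sumr; apply: eq_bigr => i _.
by rewrite !mderivZ -!scalerAl -scalerBr.
Qed.

Lemma pbracket0l (g : O_V) : pbracket 0 g = 0.
Proof. by have := pbracketZl 0 0 g; rewrite !scale0r. Qed.

Lemma pbracketDr (f g h : O_V) : pbracket f (g + h) = pbracket f g + pbracket f h.
Proof. by rewrite pbracketC pbracketDl opprD -!pbracketC. Qed.

Lemma pbracket0r (f : O_V) : pbracket f 0 = 0.
Proof. by rewrite pbracketC pbracket0l oppr0. Qed.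

Lemma pbracket_xl i f g : pbracket (x i * f) g = x i * pbracket f g + f * dy i g.
Proof.
rewrite /pbracket mulr_sumr [in RHS](bigD1 i)//= [in LHS](bigD1 i)//=.
rewrite !mderivM dx_x dy_x eqxx.
under eq_bigr => j ji do
  rewrite !mderivM dx_x dy_x (negPf ji) !mul0r !add0r -!mulrA -mulrBr.
by rewrite mul1r mul0r; ring.
Qed.

Lemma pbracket_yl i f g : pbracket (y i * f) g = y i * pbracket f g - f * dx i g.
Proof.
rewrite /pbracket mulr_sumr [in RHS](bigD1 i)//= [in LHS](bigD1 i)//=.
rewrite !mderivM dx_y dy_y eqxx.
under eq_bigr => j ji do
  rewrite !mderivM dx_y dy_y (negPf ji) !mul0r !add0r -!mulrA -mulrBr.
by rewrite mul1r mul0r; ring.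
Qed.

Lemma pbracket1l g : pbracket (1 : O_V) g = 0.
Proof. by rewrite /pbracket big1// => i _; rewrite !mderivC !mul0r subrr. Qed.

(* [d] is only bounded below, so that the truncated degrees occurring in the
   induction are harmless. *)
Lemma commutator_pbracket_mnm m v l d : (msize v <= l.+1)%N ->
  (mdeg m + l <= d.+2)%N ->
  no 'X_[m] * no v - no v * no 'X_[m] + no (pbracket 'X_[m] v)
    \in bernstein K n d.
Proof.
(* A derivative of [v] has degree at most [l - 1], so its product with a monomial is normally
   ordered up to degree below [mdeg u + l - 1], which is at most [e]. For [l = 0] the derivative
   vanishes. *)
have low u i (w : O_V) e : (msize v <= l.+1)%N -> (mdeg u + l < e.+2)%N ->
    (no 'X_[u] * no v^`M(i) - no ('X_[u] * v^`M(i)) \in bernstein K n e) /\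
    (no v^`M(i) * no 'X_[u] - no (v^`M(i) * 'X_[u]) \in bernstein K n e).
  move=> vl ule; have := msize_mderiv i v.
  case: l vl ule => [|l] vl ule dv.
    have /eqP-> : v^`M(i) == 0.
      by rewrite -msize_poly_eq0 -leqn0 (leq_trans dv)// -subn1 leq_subLR.
    by rewrite !(normal_order0, mulr0, mul0r, subrr) rpred0.
  have dv' : (msize v^`M(i) <= l.+1)%N by lia.
  have uu : (msize ('X_[u] : O_V) <= (mdeg u).+1)%N by rewrite msizeX.
  split; [apply: bernsteinS (normal_orderM uu dv') |
          apply: bernsteinS (normal_orderM dv' uu)]; lia.
elim/mnm_ind_xy: m d => [d vl mld|i m IH d vl mld|i m IH d vl mld].
- rewrite mpolyX0 normal_order1 mul1r mulr1 subrr pbracket1l normal_order0.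
  by rewrite addr0 rpred0.
- rewrite mpolyXD -!/(x i) pbracket_xl normal_orderD !normal_order_x.
  rewrite mdegD mdeg1 in mld.
  (* The Leibniz rules for the commutator and for the bracket match: commuting [X i] with [no v]
     gives [- no (dy i v)], and what remains is a reordering error covered by [low]. *)
  have -> : X i * no 'X_[m] * no v - no v * (X i * no 'X_[m]) +
     (X i * no (pbracket 'X_[m] v) + no ('X_[m] * dy i v)) =
     X i * (no 'X_[m] * no v - no v * no 'X_[m] + no (pbracket 'X_[m] v))
     - (no (dy i v) * no 'X_[m] - no (dy i v * 'X_[m])).
    rewrite -weyl_comm_x [dy i v * _]mulrC mulrDr !mulrBr mulrBl !mulrA !opprB.
    by rewrite !addrA [RHS](+%R.[ACl 1*6*(3*4)*5*2]) addrK -!addrA.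
  apply: rpredB; first by apply/bernstein_x/IH => //; lia.
  by apply: (low _ _ 0 _ _ _).2 => //; lia.
- rewrite mpolyXD -!/(y i) pbracket_yl normal_orderB !normal_order_y.
  rewrite mdegD mdeg1 in mld.
  have -> : no 'X_[m] * D i * no v - no v * (no 'X_[m] * D i) +
     (no (pbracket 'X_[m] v) * D i - no ('X_[m] * dx i v)) =
     (no 'X_[m] * no v - no v * no 'X_[m] + no (pbracket 'X_[m] v)) * D i
     + (no 'X_[m] * no (dx i v) - no ('X_[m] * dx i v)).
    rewrite -weyl_comm_d mulrDl mulrBr !mulrBl !mulrA.
    by rewrite !addrA [RHS](+%R.[ACl 4*2*(3*6)*1*5]) addrK -!addrA.
  apply: rpredD; first by apply/bernstein_d/IH => //; lia.
  by apply: (low _ _ 0 _ _ _).1 => //; lia.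
Qed.

Lemma commutator_pbracket u v k l d :
  (msize u <= k.+1)%N -> (msize v <= l.+1)%N -> (k + l <= d.+2)%N ->
  no u * no v - no v * no u + no (pbracket u v) \in bernstein K n d.
Proof.
move=> uk vl kld; rewrite (msize_le_sum uk).
elim/big_ind: _ => [|f g Bf Bg|m mk].
- by rewrite pbracket0l !normal_order0 mul0r mulr0 subrr addr0 rpred0.
- rewrite pbracketDl !normal_orderD mulrDl mulrDr opprD.
  by rewrite !addrA (+%R.[ACl (1*3*5)*(2*4*6)]) rpredD.
- rewrite pbracketZl !normal_orderZ -scalerAl -scalerAr -scalerBr -scalerDr.
  rewrite rpredZ//; apply: commutator_pbracket_mnm vl _.
  by rewrite (leq_trans _ kld)// leq_add2r -ltnS.
Qed.

End Symbols.

(** * Equivariance of normal ordering *)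

Section Substitution.
Context (K : fieldType) (k : nat).
Implicit Types (A B : 'M[K]_k) (f g p : {mpoly K[k]}).

Lemma mpoly_actD A f g : mpoly_act A (f + g) = mpoly_act A f + mpoly_act A g.
Proof. exact: comp_mpolyD. Qed.
Lemma mpoly_actZ A a f : mpoly_act A (a *: f) = a *: mpoly_act A f.
Proof. exact: comp_mpolyZ. Qed.
Lemma mpoly_act0 A : mpoly_act A 0 = 0.
Proof. exact: comp_mpoly0. Qed.
Lemma mpoly_act1 A : mpoly_act A 1 = 1.
Proof. exact: comp_mpoly1. Qed.
Lemma mpoly_actM A f g : mpoly_act A (f * g) = mpoly_act A f * mpoly_act A g.
Proof. exact: (@comp_mpoly_is_multiplicative _ _ _ _).1. Qed.
Lemma mpoly_act_sum A I (r : seq I) (P : pred I) F :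
  mpoly_act A (\sum_(i <- r | P i) F i) = \sum_(i <- r | P i) mpoly_act A (F i).
Proof. exact: raddf_sum. Qed.
Lemma mpoly_actXU A i : mpoly_act A 'X_i = \sum_j invmx A i j *: 'X_j.
Proof. by rewrite /mpoly_act comp_mpolyXU -tnth_nth tnth_mktuple. Qed.

Lemma mpoly_actK A : A \in unitmx -> cancel (mpoly_act (invmx A)) (mpoly_act A).
Proof.
move=> Au f; elim/mpoly_ind_mulX: f => [a f g IHf IHg||i f IH].
- by rewrite !(mpoly_actD, mpoly_actZ) IHf IHg.
- by rewrite !mpoly_act1.
rewrite !mpoly_actM IH mpoly_actXU mpoly_act_sum invmxK; congr (_ * _).
under eq_bigr => j _.
  rewrite mpoly_actZ mpoly_actXU scaler_sumr.
  under eq_bigr do rewrite scalerA.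
  over.
rewrite exchange_big (bigD1 i)//= [X in _ + X]big1 => [|j ji]; last first.
  rewrite -scaler_suml; have := mulmxV Au => /matrixP/(_ i j).
  by rewrite !mxE eq_sym (negPf ji) => ->; rewrite scale0r.
rewrite addr0 -scaler_suml; have := mulmxV Au => /matrixP/(_ i i).
by rewrite !mxE eqxx => ->; rewrite scale1r.
Qed.

(** This is the chain rule. For [invmx A] it shows that partial derivatives transform as the
    coordinates [y i] do under [gl_sp A]. *)
Lemma mderiv_act A i f :
  (mpoly_act A f)^`M(i) = \sum_j invmx A j i *: mpoly_act A f^`M(j).
Proof.
elim/mpoly_ind_mulX: f => [a f g IHf IHg||l f IH].
- rewrite !(mpoly_actD, mpoly_actZ, mderivD, mderivZ) IHf IHg.
  rewrite scaler_sumr -big_split; apply: eq_bigr => j _ /=.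
  by rewrite mderivD mderivZ mpoly_actD mpoly_actZ scalerDr !scalerA mulrC.
- rewrite mpoly_act1 mderivC big1// => j _.
  by rewrite mderivC mpoly_act0 scaler0.
rewrite mpoly_actM mderivM IH.
under [in RHS]eq_bigr do rewrite mderivM mderivXU mpoly_actD !mpoly_actM scalerDr.
rewrite big_split /=; congr (_ + _); last first.
  by rewrite mulr_sumr; apply: eq_bigr => j _; rewrite scalerAr.
rewrite [in RHS](bigD1 l)//= [X in _ = _ + X]big1 => [|j jl]; last first.
  by rewrite (negPf jl) mpoly_act0 mul0r scaler0.
rewrite eqxx mpoly_act1 mul1r addr0.
rewrite -[invmx A l i *: _]mulr_algl; congr (_ * _).
rewrite mpoly_actXU linear_sum (bigD1 i)//= [X in _ + X]big1 => [|j ji].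
  by rewrite mderivZ mderivXU eqxx addr0.
by rewrite mderivZ mderivXU eq_sym (negPf ji) scaler0.
Qed.

Lemma dhomog_actX A m : mpoly_act A 'X_[m] \is (mdeg m).-homog.
Proof.
elim/mnm_ind: m => [|i m IH]; first by rewrite mpolyX0 mpoly_act1 mdeg0 dhomog1.
rewrite mpolyXD mpoly_actM mdegD mdeg1; apply: dhomogM IH.
rewrite mpoly_actXU; apply: rpred_sum => j _.
by rewrite rpredZ// dhomogX; apply/eqP/mdeg1.
Qed.

Lemma pihomog_act A d f :
  pihomog mdeg d (mpoly_act A f) = mpoly_act A (pihomog mdeg d f).
Proof.
elim/mpoly_ind_monom: f => [a f g IHf IHg|m].
  by rewrite mpoly_actD mpoly_actZ !linearP /= IHf IHg mpoly_actD mpoly_actZ.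
rewrite pihomogX; case: eqP => [<-|/eqP md].
  by rewrite pihomog_dE// dhomog_actX.
by rewrite mpoly_act0 (pihomog_ne0 md)// dhomog_actX.
Qed.

End Substitution.

Section Equivariance.
Context (K : fieldType) (n : nat).
Local Notation O_V := {mpoly K[n + n]}.
Local Notation W := (weyl K n).
Local Notation no := (@normal_order K n).
Local Notation x := (@coord_x K n).
Local Notation y := (@coord_y K n).
Implicit Types (A : 'M[K]_n) (f : O_V).

Lemma invmx_gl_sp A : A \in unitmx ->
  invmx (gl_sp A) = block_mx (invmx A) 0 0 A^T.
Proof.
move=> Au; rewrite /gl_sp invmx_block_diag ?trmx_inv ?invmxK//.
rewrite unitmxE det_lblock unitrM -!unitmxE Au.
by rewrite unitmx_inv unitmx_tr.
Qed.

Lemma mpoly_act_gl_sp_x A i : A \in unitmx ->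
  mpoly_act (gl_sp A) (x i) = \sum_j invmx A i j *: x j.
Proof.
move=> Au; rewrite mpoly_actXU big_split_ord /= [X in _ + X]big1 ?addr0 => [|j _].
  by apply: eq_bigr => j _; rewrite invmx_gl_sp// block_mxEul.
by rewrite invmx_gl_sp// block_mxEur mxE scale0r.
Qed.

Lemma mpoly_act_gl_sp_y A i : A \in unitmx ->
  mpoly_act (gl_sp A) (y i) = \sum_j A j i *: y j.
Proof.
move=> Au; rewrite mpoly_actXU big_split_ord /= [X in X + _]big1 ?add0r => [|j _].
  by apply: eq_bigr => j _; rewrite invmx_gl_sp// block_mxEdr mxE.
by rewrite invmx_gl_sp// block_mxEdl mxE scale0r.
Qed.

Lemma weylD (P : W) p q : P (p + q) = P p + P q.
Proof. by have := diffop_linear (weyl_diffop P) 1 p q; rewrite !scale1r. Qed.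
Lemma weyl0 (P : W) : P 0 = 0.
Proof. by apply: (addrI (P 0)); rewrite -weylD !addr0. Qed.
Lemma weylZ (P : W) a p : P (a *: p) = a *: P p.
Proof. by have := diffop_linear (weyl_diffop P) a p 0; rewrite weyl0 !addr0. Qed.
Lemma weyl_sum (P : W) I (r : seq I) (F : I -> _) :
  P (\sum_(i <- r) F i) = \sum_(i <- r) P (F i).
Proof. exact: (big_morph P (weylD P) (weyl0 P)). Qed.
Lemma weyl_sumE I (r : seq I) (F : I -> W) p :
  (\sum_(i <- r) F i) p = \sum_(i <- r) F i p.
Proof. by elim/big_rec2: _ => // i q P _ <-. Qed.
Lemma normal_order_sum I (r : seq I) (F : I -> O_V) :
  no (\sum_(i <- r) F i) = \sum_(i <- r) no (F i).
Proof. exact: linear_sum. Qed.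

(** Conjugation by [A] mixes the [X j] only among themselves and the [D j] only among themselves, so
    it respects normal ordering; on the [D j] it is computed by the chain rule. *)
Lemma normal_order_act A f p : A \in unitmx ->
  mpoly_act A (no f (mpoly_act (invmx A) p)) = no (mpoly_act (gl_sp A) f) p.
Proof.
move=> Au; elim/mpoly_ind_xy: f p => [a f g IHf IHg p|p|i f IH p|i f IH p].
- rewrite mpoly_actD mpoly_actZ !normal_order_is_linear !(weyl_addE, weyl_scaleE).
  by rewrite mpoly_actD mpoly_actZ IHf IHg.
- by rewrite mpoly_act1 !normal_order1 !weyl_1E mpoly_actK.
- rewrite mpoly_actM mpoly_act_gl_sp_x// mulr_suml.
  rewrite normal_order_sum weyl_sumE normal_order_x weyl_mulE /= mpoly_actM IH.
  rewrite mpoly_actXU mulr_suml; apply: eq_bigr => j _.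
  by rewrite -!scalerAl normal_orderZ normal_order_x weyl_scaleE weyl_mulE.
- rewrite mpoly_actM mpoly_act_gl_sp_y// mulr_suml.
  rewrite normal_order_sum weyl_sumE normal_order_y weyl_mulE /=.
  rewrite mderiv_act weyl_sum mpoly_act_sum; apply: eq_bigr => j _.
  rewrite invmxK weylZ mpoly_actZ IH -scalerAl normal_orderZ normal_order_y.
  by rewrite weyl_scaleE weyl_mulE.
Qed.

Lemma weyl_invariant_normal_order (G : set 'M[K]_n) f :
  (forall A, G A -> A \in unitmx) ->
  O_V_invariant G f -> weyl_invariant G (no f).
Proof.
move=> Gu Gf A GA; apply/funext => p /=.
by rewrite normal_order_act ?Gf//; apply: Gu.
Qed.

Lemma O_V_invariant_pihomog (G : set 'M[K]_n) d f :
  O_V_invariant G f -> O_V_invariant G (pihomog mdeg d f).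
Proof. by move=> Gf A GA; rewrite -pihomog_act Gf. Qed.

End Equivariance.

(** * The symbol map *)

Section Quotients.
Context (K : fieldType) (V : lmodType K) (U : submodClosed V).

Lemma qproj_eq0 (v : V) : qproj U v = 0 <-> v \in U.
Proof.
by have := qprojP U v 0; rewrite subr0 (linear0 (@qproj K V U)).
Qed.

End Quotients.

Section SymbolMap.
Context (K : fieldType) (n : nat) (G : set 'M[K]_n).
Local Notation O_V := {mpoly K[n + n]}.
Local Notation W := (weyl K n).
Local Notation no := (@normal_order K n).
Local Notation F := (filtHH0 G).

(** Extracting the part of degree [k] first makes this defined, and linear, on all polynomials,
    whereas [symbol_class] needs a homogeneous argument. *)
Definition symbol_component k (f : O_V) : gr_piece F k :=
  qproj _ (Submod (normal_order_filt G (DHomog (pihomogP mdeg k f)))).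

Lemma symbol_component_is_linear k : linear (symbol_component k).
Proof.
move=> a f g; rewrite /symbol_component -linearP /=; congr qproj.
apply: val_inj => /=; rewrite -linearP /=; congr qproj.
by rewrite -normal_order_is_linear -linearP.
Qed.
HB.instance Definition _ k :=
  GRing.isLinear.Build K O_V (gr_piece F k) _ (symbol_component k)
    (symbol_component_is_linear k).

Lemma symbol_component_eq0 k f : symbol_component k f = 0 <->
  exists2 P, P \in bernstein K n k & no (pihomog mdeg k f) - P \in commutators G.
Proof.
rewrite qproj_eq0; split=> [/asboolP[P Pk /qprojP PE]|[P Pk PE]]; first by exists P.
by apply/asboolP; exists P => //=; apply/qprojP.
Qed.

Lemma symbol_component_fin f :
  `[< exists N : nat, forall k, (N <= k)%N -> symbol_component k f = 0 >].
Proof.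
apply/asboolP; exists (msize f) => k fk.
suff f0 : pihomog mdeg k f = 0.
  apply/symbol_component_eq0; exists 0; first by rewrite rpred0.
  by rewrite f0 normal_order0 subr0 rpred0.
rewrite pihomogE big_seq_cond big1// => m /andP[/msize_mdeg_lt mf /eqP mk].
by move: mf; rewrite mk ltnNge fk.
Qed.

Definition symbol_map (f : O_V) : grHH0 G := DSum (symbol_component_fin f).

Lemma symbol_map_is_linear : linear symbol_map.
Proof. by move=> a f g; apply/dsumP => k; apply: symbol_component_is_linear. Qed.
HB.instance Definition _ :=
  GRing.isLinear.Build K O_V (grHH0 G) _ symbol_map symbol_map_is_linear.

Lemma symbol_map_dhomog k (f : dhomog (n + n) K k) :
  symbol_map f = symbol_class G f.
Proof.
have fk := dhomog_is_dhomog f.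
apply/dsumP => l /=; have [<-|kl] := eqVneq k l.
  rewrite dfwith_in; congr qproj; apply: val_inj => /=.
  by rewrite pihomog_dE.
rewrite dfwith_out//; apply/symbol_component_eq0.
by exists 0; rewrite ?rpred0// (pihomog_ne0 kl)// normal_order0 subr0 rpred0.
Qed.

Lemma pbracket_suml I (r : seq I) (h : I -> O_V) g :
  pbracket (\sum_(i <- r) h i) g = \sum_(i <- r) pbracket (h i) g.
Proof.
exact: (big_morph (fun f => pbracket f g) (fun f f' => pbracketDl f f' g)
  (pbracket0l g)).
Qed.

Lemma pbracket_sumr I (r : seq I) (h : I -> O_V) g :
  pbracket g (\sum_(i <- r) h i) = \sum_(i <- r) pbracket g (h i).
Proof.
exact: (big_morph (fun f => pbracket g f) (fun f f' => pbracketDr g f f')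
  (pbracket0r g)).
Qed.

Lemma dhomog_mderiv k d (i : 'I_k) (f : {mpoly K[k]}) :
  f \is d.-homog -> f^`M(i) \is d.-1.-homog.
Proof.
move=> /dhomogP fd; apply/dhomogP => m.
rewrite mcoeff_msupp mcoeff_mderiv => mf.
have mUf : (m + U_(i))%MM \in msupp f.
  by rewrite mcoeff_msupp; apply: contraNneq mf => ->; rewrite mul0rn.
have : mdeg (m + U_(i))%MM = d by exact: fd.
by rewrite mdegD mdeg1 addn1 => <-.
Qed.

Lemma dhomog_msize_le k d (f : {mpoly K[k]}) : f \is d.-homog -> (msize f <= d.+1)%N.
Proof.
move=> /dhomogP fd; rewrite msizeE; apply/bigmax_leqP_seq => m mf _.
by rewrite (fd m mf).
Qed.

Lemma dhomog_mderiv0 k (i : 'I_k) (f : {mpoly K[k]}) : f \is 0.-homog -> f^`M(i) = 0.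
Proof.
by move=> /dhomog_msize_le/msize1_polyC->; rewrite mderivC.
Qed.

Lemma dhomog_pbracket k l d (f g : O_V) : f \is k.-homog -> g \is l.-homog ->
  (k + l = d.+2)%N -> pbracket f g \is d.-homog.
Proof.
move=> fk gl kld; apply: rpred_sum => i _.
have H a b : f^`M(a) * g^`M(b) \is d.-homog.
  case: k fk kld => [|k] fk kld.
    by rewrite dhomog_mderiv0// mul0r rpred0.
  case: l gl kld => [|l] gl kld.
    by rewrite (dhomog_mderiv0 _ gl) mulr0 rpred0.
  have -> : d = (k + l)%N by lia.
  by apply: dhomogM; apply: (@dhomog_mderiv _ _.+1).
by rewrite rpredB ?H.
Qed.

Lemma pbracket_low k l (f g : O_V) : f \is k.-homog -> g \is l.-homog ->
  (k + l < 2)%N -> pbracket f g = 0.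
Proof.
move=> fk gl kl; rewrite /pbracket big1// => i _.
have [/eqP k0|/eqP l0] : k == 0%N \/ l == 0%N by lia.
  by rewrite k0 in fk; rewrite !(dhomog_mderiv0 _ fk) !mul0r subr0.
by rewrite l0 in gl; rewrite !(dhomog_mderiv0 _ gl) !mulr0 subr0.
Qed.

Lemma mcoeff_pihomog k d (f : {mpoly K[k]}) m :
  (pihomog mdeg d f)@_m = f@_m *+ (mdeg m == d).
Proof.
elim/mpoly_ind_monom: f => [a f g IHf IHg|l].
  by rewrite !linearP /= IHf IHg mulrnDl mulrnAr.
rewrite pihomogX mcoeffX; have [<-|lm] := eqVneq l m.
  by case: eqP => _; rewrite ?mcoeff0// mcoeffX eqxx.
by case: ifP => _; rewrite ?mcoeff0 ?mcoeffX ?(negPf lm) mul0rn.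
Qed.

Hypothesis Gu : forall A, G A -> A \in unitmx.

(** For invariant [f] the commutator of [no f] and [no g] vanishes in HH_0, while it equals
    [- no (pbracket f g)] up to terms of lower degree. *)
Lemma symbol_map_pbracket_homog k l f g : O_V_invariant G f ->
  f \is k.-homog -> g \is l.-homog -> symbol_map (pbracket f g) = 0.
Proof.
move=> Gf fk gl; have [kl|kl] := ltnP (k + l) 2.
  by rewrite (pbracket_low fk gl kl) linear0.
(* The degree of the bracket; the subtraction is not truncated, as total degrees below 2 have been
   dealt with. *)
pose d := (k + l - 2)%N; have kld : (k + l = d.+2)%N by rewrite /d; lia.
have fgd := dhomog_pbracket fk gl kld.
apply/dsumP => j /=; apply/symbol_component_eq0.
have [dj|dj] := eqVneq d j; last first.
  by exists 0; rewrite ?rpred0// (pihomog_ne0 dj)// normal_order0 subr0 rpred0.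
rewrite -dj pihomog_dE//.
exists (no f * no g - no g * no f + no (pbracket f g)).
  apply: (commutator_pbracket (k := k) (l := l)); rewrite ?dhomog_msize_le//.
  by rewrite kld.
rewrite opprD addrCA subrr addr0 rpredN; apply: Defs.sub_span.
by exists (no f), (no g); split=> //; apply: weyl_invariant_normal_order.
Qed.

(** Both arguments of a bracket split into homogeneous parts, and the parts of an invariant are
    invariant because linear substitutions preserve degree. *)
Lemma symbol_map_pbrackets f : f \in pbrackets G -> symbol_map f = 0.
Proof.
move=> /asboolP/(_ (fun f => symbol_map f = 0)); apply.
- exact: linear0.
- by move=> a u w /= u0 w0; rewrite symbol_map_is_linear u0 w0 scaler0 addr0.
move=> _ [u [v [Gu' ->]]].
rewrite (pihomog_partitionE (mf := mdeg) (leqnn (msize u))).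
rewrite pbracket_suml linear_sum big1// => i _ /=.
rewrite (pihomog_partitionE (mf := mdeg) (leqnn (msize v))).
rewrite pbracket_sumr linear_sum big1// => j _ /=.
apply: (symbol_map_pbracket_homog (k := i) (l := j)); rewrite ?pihomogP//.
exact: O_V_invariant_pihomog.
Qed.

Definition HP0_symbol (q : HP0 G) : grHH0 G := symbol_map (quot_repr q).

Lemma HP0_symbolE f : HP0_symbol (qproj (pbrackets G) f) = symbol_map f.
Proof.
apply/eqP; rewrite -subr_eq0 -linearB /=; apply/eqP/symbol_map_pbrackets.
by apply/qprojP; rewrite quot_reprK.
Qed.

Lemma HP0_symbol_is_linear : linear HP0_symbol.
Proof.
move=> a p q; rewrite -[p]quot_reprK -[q]quot_reprK -linearP /=.
by rewrite !HP0_symbolE symbol_map_is_linear.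
Qed.

Definition HP0_symbol_linear : {linear HP0 G -> grHH0 G} :=
  HB.pack HP0_symbol
    (GRing.isLinear.Build K (HP0 G) (grHH0 G) _ HP0_symbol HP0_symbol_is_linear).

Lemma HP0_symbol_surj (z : grHH0 G) : exists q, HP0_symbol q = z.
Proof.
have piece k (w : gr_piece F k) : exists f, f \is k.-homog /\ symbol_component k f = w.
  rewrite -[w]quot_reprK; case: (quot_repr w) => v Fv.
  have /asboolP[P /bernsteinP[f fk ->] vE] := Fv.
  (* Only the top part matters: [f] has degree at most [k], so it differs from its part of degree
     [k] by terms of lower filtration degree. *)
  exists (pihomog mdeg k f); split; first exact: pihomogP.
  apply/qprojP; rewrite /=; apply/asboolP.
  exists (no (pihomog mdeg k f) - no f); last first.
    by rewrite [RHS]linearB /= vE pihomog_id.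
  rewrite -normal_orderB; apply: normal_order_bernstein.
  rewrite msizeE; apply/bigmax_leqP_seq => m.
  rewrite mcoeff_msupp mcoeffB => mf _.
  rewrite ltnNge; apply: contraNN mf => km.
  rewrite mcoeff_pihomog subr_eq0; move: km; rewrite leq_eqVlt eq_sym.
  case: eqP => // _ /= km; rewrite eq_sym mcoeff_eq0; apply: msize_mdeg_ge.
  exact: leq_trans km.
have [N zN] := dsum_fin z.
have [f fP] := choice (fun k => piece k (z k)).
(* The components of [z] vanish from [N] on, and homogeneous lifts of different degrees do not
   interfere. *)
exists (qproj _ (\sum_(k < N) f k)).
rewrite HP0_symbolE; apply/dsumP => k /=.
rewrite linear_sum.
have off l : l != k -> symbol_component k (f l) = 0.
  move=> lk; apply/symbol_component_eq0.
  by exists 0; rewrite ?rpred0// (pihomog_ne0 lk (fP l).1)// normal_order0 subr0 rpred0.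
have [kN|Nk] := ltnP k N.
  rewrite (bigD1 (Ordinal kN))//= big1 => [|l lk]; last exact: off.
  by rewrite addr0 (fP k).2.
rewrite zN// big1// => l _; apply: off; rewrite neq_ltn.
by rewrite (leq_trans (ltn_ord l)).
Qed.

End SymbolMap.

(** * Spanning HP_0 *)

Section Spanning.
Context (K : fieldType) (K0 : [pchar K] =i pred0) (m : nat) (m_gt0 : (0 < m)%N).
Context (G : set 'M[K]_2).
Local Notation x := (@coord_x K 2).
Local Notation y := (@coord_y K 2).
Local Notation dx i f := (mderiv (lshift 2 i) f).
Local Notation dy i f := (mderiv (rshift 2 i) f).
Local Notation B := (pbrackets G).

Hypothesis Gxx : O_V_invariant G (x 0 * x 1).
Hypothesis Gxy : O_V_invariant G (x 0 * y 0 + x 1 * y 1).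
Hypothesis Gxm : O_V_invariant G (x 0 ^+ m + x 1 ^+ m).

Definition mon4 a b c d : {mpoly K[2 + 2]} :=
  x 0 ^+ a * x 1 ^+ b * y 0 ^+ c * y 1 ^+ d.

Lemma mderiv_exp k (i : 'I_k) (f : {mpoly K[k]}) e :
  (f ^+ e)^`M(i) = e%:R * f ^+ e.-1 * f^`M(i).
Proof.
elim: e => [|e IH]; first by rewrite mderivC !mul0r.
rewrite exprS mderivM IH /=; case: e {IH} => [|e] /=.
  by rewrite !mul0r mul1r; ring.
by rewrite -[in RHS]natr1 exprS; ring.
Qed.

Lemma mon4_dx0 a b c d : dx 0 (mon4 a b c d) = a%:R * mon4 a.-1 b c d.
Proof. by rewrite /mon4 !mderivM !mderiv_exp !dx_x !dx_y /=; ring. Qed.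
Lemma mon4_dx1 a b c d : dx 1 (mon4 a b c d) = b%:R * mon4 a b.-1 c d.
Proof. by rewrite /mon4 !mderivM !mderiv_exp !dx_x !dx_y /=; ring. Qed.
Lemma mon4_dy0 a b c d : dy 0 (mon4 a b c d) = c%:R * mon4 a b c.-1 d.
Proof. by rewrite /mon4 !mderivM !mderiv_exp !dy_x !dy_y /=; ring. Qed.
Lemma mon4_dy1 a b c d : dy 1 (mon4 a b c d) = d%:R * mon4 a b c d.-1.
Proof. by rewrite /mon4 !mderivM !mderiv_exp !dy_x !dy_y /=; ring. Qed.

Lemma pbracket_x i (g : {mpoly K[2 + 2]}) : pbracket (x i) g = dy i g.
Proof. by rewrite -[x i]mulr1 pbracket_xl pbracket1l mulr0 add0r mul1r. Qed.
Lemma pbracket_y i (g : {mpoly K[2 + 2]}) : pbracket (y i) g = - dx i g.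
Proof. by rewrite -[y i]mulr1 pbracket_yl pbracket1l mulr0 add0r mul1r. Qed.
Lemma pbracket_xn i e (g : {mpoly K[2 + 2]}) :
  pbracket (x i ^+ e) g = e%:R * x i ^+ e.-1 * dy i g.
Proof.
elim: e => [|e IH]; first by rewrite pbracket1l !mul0r.
rewrite exprS pbracket_xl IH /=; case: e {IH} => [|e] /=.
  by rewrite !mul0r; ring.
by rewrite -[in RHS]natr1 exprS; ring.
Qed.

Lemma mem_pbrackets f g : O_V_invariant G f -> pbracket f g \in B.
Proof. by move=> Gf; apply: Defs.sub_span; exists f, g. Qed.

Lemma natr_mem e (f : {mpoly K[2 + 2]}) : (0 < e)%N -> e%:R * f \in B -> f \in B.
Proof.
move=> e0; rewrite mulr_natl -scaler_nat => Bf.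
by rewrite -[f]scale1r -(@mulVf K e%:R) ?((pcharf0P K).1 K0) -?lt0n// -scalerA rpredZ.
Qed.

Lemma mem_natr e (f : {mpoly K[2 + 2]}) : f \in B -> e%:R * f \in B.
Proof. by move=> Bf; rewrite mulr_natl rpredMn. Qed.

(** This comes from bracketing with the invariant [x 0 * x 1]. An exponent [c.-1] or [d.-1] is
    truncated only when its coefficient is zero. *)
Lemma relation_xx a b c d : c%:R * mon4 a b.+1 c.-1 d + d%:R * mon4 a.+1 b c d.-1 \in B.
Proof.
rewrite (_ : _ + _ = pbracket (x 0 * x 1) (mon4 a b c d)); first exact: mem_pbrackets.
by rewrite pbracket_xl pbracket_x mon4_dy0 mon4_dy1 /mon4 !exprS; ring.
Qed.

(** Bracketing with [x 0 * y 0 + x 1 * y 1] multiplies a monomial by its degree in the [y i] minus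
    its degree in the [x i], here a nonzero integer. *)
Lemma relation_xy a b c d : (a + b != c + d)%N -> mon4 a b c d \in B.
Proof.
move=> abcd; have := mem_pbrackets (mon4 a b c d) Gxy.
rewrite pbracketDl !pbracket_xl !pbracket_y mon4_dx0 mon4_dx1 mon4_dy0 mon4_dy1.
have -> : x 0 * - (a%:R * mon4 a.-1 b c d) = - (a%:R * mon4 a b c d).
  by case: a {abcd} => [|a]; rewrite /mon4 /= ?exprS; ring.
have -> : x 1 * - (b%:R * mon4 a b.-1 c d) = - (b%:R * mon4 a b c d).
  by case: b {abcd} => [|b]; rewrite /mon4 /= ?exprS; ring.
have -> : y 0 * (c%:R * mon4 a b c.-1 d) = c%:R * mon4 a b c d.
  by case: c {abcd} => [|c]; rewrite /mon4 /= ?exprS; ring.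
have -> : y 1 * (d%:R * mon4 a b c d.-1) = d%:R * mon4 a b c d.
  by case: d {abcd} => [|d]; rewrite /mon4 /= ?exprS; ring.
rewrite (_ : _ + _ = ((c + d)%:R - (a + b)%:R) * mon4 a b c d); last first.
  by rewrite !natrD; ring.
case: (ltngtP (a + b) (c + d)) abcd => // lt _ Bf.
  by apply: (@natr_mem (c + d - (a + b))); rewrite ?subn_gt0// natrB ?(ltnW lt).
apply: (@natr_mem (a + b - (c + d))); rewrite ?subn_gt0// natrB ?(ltnW lt)//.
by rewrite -rpredN -mulNr opprB.
Qed.

(** By [relation_xx] the monomial is traded for one with [a] and [c] both lowered by one. The
    descent ends at [c = 0], where the relation has a single term. *)
Lemma mon4_mem_gt a b c d : (c < a)%N -> mon4 a b c d \in B.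
Proof.
elim: c a b d => [|c IH] [|a] b d //= ca; apply: (@natr_mem d.+1) => //.
  by have := relation_xx a b 0 d.+1; rewrite mul0r add0r.
have := relation_xx a b c.+1 d.+1 => /=.
by rewrite rpredDl// mem_natr// IH.
Qed.

Lemma mon4_mem_gt1 a b c d : (d < b)%N -> mon4 a b c d \in B.
Proof.
elim: d a b c => [|d IH] a [|b] c //= db; apply: (@natr_mem c.+1) => //.
  by have := relation_xx a b c.+1 0; rewrite mul0r addr0.
have := relation_xx a b c.+1 d.+1 => /=.
by rewrite rpredDr// mem_natr// IH.
Qed.

Lemma mon4_mem a b c d : (a, b) != (c, d) -> mon4 a b c d \in B.
Proof.
move=> ne; have [ac|ac] := ltnP c a; first exact: mon4_mem_gt.
have [bd|bd] := ltnP d b; first exact: mon4_mem_gt1.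
(* Now [a <= c] and [b <= d], so different exponents force different total degrees. *)
apply: relation_xy; apply: contraNneq ne => E; rewrite xpair_eqE; lia.
Qed.

(** On diagonal monomials [relation_xx] moves one unit from the second exponent to the first, with a
    sign and a ratio of integers; after [j] moves these accumulate to [(-1) ^+ j] and a binomial
    coefficient. *)
Lemma mon4_diag i j :
  'C(i + j, j)%:R * mon4 i j i j - (-1) ^+ j * mon4 (i + j) 0 (i + j) 0 \in B.
Proof.
elim: j i => [|j IH] i.
  by rewrite addn0 bin0 !mul1r subrr rpred0.
apply: (@natr_mem i.+1) => //.
have -> : i.+1%:R * ('C(i + j.+1, j.+1)%:R * mon4 i j.+1 i j.+1
    - (-1) ^+ j.+1 * mon4 (i + j.+1) 0 (i + j.+1) 0) =
  'C(i + j.+1, j.+1)%:R * (i.+1%:R * mon4 i j.+1 i j.+1 + j.+1%:R * mon4 i.+1 j i.+1 j)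
  - i.+1%:R * ('C(i.+1 + j, j)%:R * mon4 i.+1 j i.+1 j
      - (-1) ^+ j * mon4 (i.+1 + j) 0 (i.+1 + j) 0) :> {mpoly K[2 + 2]}.
  have E : j.+1%:R * 'C(i + j.+1, j.+1)%:R =
      i.+1%:R * 'C(i.+1 + j, j)%:R :> {mpoly K[2 + 2]}.
    rewrite -!natrM; congr (_%:R); rewrite -(addSnnS i j).
    have := mul_bin_left (i.+1 + j) j; rewrite addnK => ->; lia.
  rewrite -(addSnnS i j) in E *; rewrite exprS.
  rewrite [X in _ = X - _]mulrDr [X in _ = _ + X - _]mulrA [_ * j.+1%:R]mulrC E; ring.
apply: rpredB; apply: mem_natr; last exact: IH.
exact: relation_xx i j i.+1 j.+1.
Qed.

(** The bracket of [x 0 ^+ m + x 1 ^+ m] with [mon4 (a.+1 - m) 0 a.+1 0] is the required monomial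
    times [m * a.+1]; the term in [x 1] contributes nothing, as [y 1] does not occur. *)
Lemma mon4_top a : (m <= a.+1)%N -> mon4 a 0 a 0 \in B.
Proof.
move=> ma; apply: (@natr_mem (m * a.+1)); first by rewrite muln_gt0 m_gt0.
rewrite (_ : _ * _ = pbracket (x 0 ^+ m + x 1 ^+ m) (mon4 (a.+1 - m) 0 a.+1 0)).
  exact: mem_pbrackets.
rewrite pbracketDl !pbracket_xn mon4_dy0 mon4_dy1 /= mul0r mulr0 addr0 natrM /mon4.
have -> : x 0 ^+ a = x 0 ^+ m.-1 * x 0 ^+ (a.+1 - m).
  by rewrite -exprD; congr (_ ^+ _); lia.
ring.
Qed.

(* [HP0_generator] over an arbitrary field. *)
Definition HP0_gen (a : nat) : {mpoly K[2 + 2]} :=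
  x 0 ^+ a * y 0 ^+ a + (-1) ^+ a * (x 1 ^+ a * y 1 ^+ a).

(** The sign in the generator cancels the sign in [mon4_diag], so its two summands have the same
    class. *)
Lemma HP0_gen_mem a : HP0_gen a - 2%:R * mon4 a 0 a 0 \in B.
Proof.
have := mon4_diag 0 a; rewrite add0n binn mul1r => H.
have -> : HP0_gen a - 2%:R * mon4 a 0 a 0 =
    (-1) ^+ a * (mon4 0 a 0 a - (-1) ^+ a * mon4 a 0 a 0).
  by rewrite mulrBr signrMK /HP0_gen /mon4; ring.
by rewrite rpredMsign.
Qed.

Lemma HP0_span (q : HP0 G) : exists c : 'I_m.-1 -> K,
  q = \sum_i c i *: qproj B (HP0_gen i).
Proof.
rewrite -[q]quot_reprK; elim/mpoly_ind_monom: (quot_repr q) => [a f g [c cE] [d dE]|e].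
  exists (fun i => a * c i + d i); rewrite linearP /= cE dE scaler_sumr -big_split.
  by apply: eq_bigr => i _; rewrite scalerDl scalerA.
have -> : 'X_[e] = mon4 (e (lshift 2 0)) (e (lshift 2 1))
    (e (rshift 2 0)) (e (rshift 2 1)).
  rewrite mpolyXE_id big_split_ord /= !big_ord_recl !big_ord0 /= !mulr1 !mulrA.
  by rewrite (_ : lift ord0 ord0 = 1)//; apply: val_inj.
move: (e _) (e _) (e _) (e _) => d c b a {q e}.
have [|/mon4_mem/qproj_eq0 M0] := eqVneq (a, b) (c, d); last first.
  by exists (fun=> 0); rewrite big1 => [|i _]; [exact: M0 | by rewrite scale0r].
case=> <- <- {c d}.
have n0 k : (0 < k)%N -> k%:R != 0 :> K by rewrite ((pcharf0P K).1 K0) -lt0n.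
set l := (a + b)%N.
(* The sign and the inverse binomial coefficient come from [mon4_diag], the factor one half from
   [HP0_gen_mem]. *)
have E : qproj B (mon4 a b a b) =
    ('C(l, b)%:R^-1 * (-1) ^+ b * 2%:R^-1) *: qproj B (HP0_gen l).
  have := HP0_gen_mem l => /qproj_eq0; rewrite linearB /= => /subr0_eq ->.
  rewrite mulr_natl linearMn -scaler_nat scalerA mulfVK ?n0//.
  have /qproj_eq0 := mon4_diag a b; rewrite linearB /= => /subr0_eq.
  rewrite mulr_natl linearMn -scaler_nat => /(congr1 (fun z => 'C(l, b)%:R^-1 *: z)).
  rewrite scalerA mulVf ?n0 ?bin_gt0 ?leq_addl// scale1r => ->.
  rewrite -scalerA; congr (_ *: _).
  rewrite -(signr_odd {mpoly K[2 + 2]} b) -(signr_odd K b) mulr_sign scaler_sign.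
  by case: odd; rewrite ?linearN.
have [lm|ml] := ltnP l m.-1.
  exists (fun i => if i == Ordinal lm then 'C(l, b)%:R^-1 * (-1) ^+ b * 2%:R^-1 else 0).
  rewrite (bigD1 (Ordinal lm))//= eqxx big1 ?addr0// => i /negPf->.
  by rewrite scale0r.
(* From [l = m - 1] on, the generator itself lies in the span of the brackets. *)
exists (fun=> 0); rewrite big1 => [|i _]; last by rewrite scale0r.
suff HP0l : qproj B (HP0_gen l) = 0 by rewrite E HP0l scaler0.
apply/qproj_eq0; rewrite -[HP0_gen l](subrK (2%:R * mon4 l 0 l 0)).
by rewrite rpredD ?HP0_gen_mem// mem_natr// mon4_top//; lia.
Qed.

End Spanning.

(** * Twisted traces *)

Section TwistedTrace.
Context (K : fieldType) (K0 : [pchar K] =i pred0) (n : nat).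
Local Notation O_V := {mpoly K[n + n]}.
Local Notation W := (weyl K n).
Local Notation no := (@normal_order K n).
Local Notation x := (@coord_x K n).
Local Notation y := (@coord_y K n).
Local Notation dx i f := (mderiv (lshift n i) f).
Local Notation dy i f := (mderiv (rshift n i) f).
Local Notation X := (@weyl_x K n).
Local Notation D := (@weyl_d K n).

Context (c : 'I_n -> {poly K}).

(* If g scales x_i by q, the regularized trace of x_i^a d_i^b g on C[x_i] is
   proportional to this, with c i = q / (1 - q). *)
Definition trace_factor i (a b : nat) : {poly K} :=
  if a == b then a`!%:R * c i ^+ a else 0.

Definition trace_mon (m : 'X_{1..n + n}) : {poly K} :=
  \prod_i trace_factor i (m (lshift n i)) (m (rshift n i)).

Definition trace_poly (f : O_V) : {poly K} :=
  \sum_(m <- msupp f) f@_m *: trace_mon m.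

(** A common finite index set replaces the supports, which differ from one polynomial to another;
    linearity is then termwise. *)
Lemma trace_polywE k f : (msize f <= k)%N ->
  trace_poly f = \sum_(m : 'X_{1..(n + n) < k}) f@_m *: trace_mon m.
Proof.
move=> fk; set I : subFinType _ := 'X_{1..(n + n) < k}.
rewrite /trace_poly (big_mksub I) //=; first last.
- by move=> m /msize_mdeg_lt /leq_trans /(_ fk) ->.
- by rewrite msupp_uniq.
rewrite big_rmcond //= => m /memN_msupp_eq0 ->.
by rewrite scale0r.
Qed.

Lemma trace_poly_is_linear : linear trace_poly.
Proof.
move=> a f g; pose k := maxn (msize (a *: f + g)) (maxn (msize f) (msize g)).
rewrite !(@trace_polywE k) ?leq_max ?leqnn ?orbT//.
rewrite scaler_sumr -big_split; apply: eq_bigr => m _ /=.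
by rewrite linearP /= scalerDl scalerA.
Qed.
HB.instance Definition _ :=
  GRing.isLinear.Build K O_V {poly K} _ trace_poly trace_poly_is_linear.

Lemma trace_polyX m : trace_poly 'X_[m] = trace_mon m.
Proof. by rewrite /trace_poly msuppX big_seq1 mcoeffX eqxx scale1r. Qed.

Lemma trace_poly_xy i a : trace_poly (x i ^+ a * y i ^+ a) = a`!%:R * c i ^+ a.
Proof.
rewrite !mpolyXn -mpolyXD trace_polyX /trace_mon (bigD1 i)//= big1 => [|j ji].
  rewrite mulr1 !mnmDE !mulmnE !mnm1E !eqxx eq_lrshift eq_rlshift.
  by rewrite !(mul0n, mul1n) addn0 add0n /trace_factor eqxx.
rewrite !mnmDE !mulmnE !mnm1E eq_lshift eq_rshift eq_lrshift eq_rlshift.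
by rewrite eq_sym (negPf ji) /trace_factor eqxx mul1r.
Qed.

(** A monomial contributes only if its exponents in [x i] and [y i] agree for all [i]. Its trace is
    then a product of half as many [c i] as its degree, hence of fewer than [a] polynomials of
    degree at most one. *)
Lemma size_trace_poly a f : (forall i, (size (c i) <= 2)%N) ->
  (msize f <= a.*2)%N -> (size (trace_poly f) <= a)%N.
Proof.
move=> c2 fa; apply: leq_trans (size_sum _ _ _) _.
apply/bigmax_leqP_seq => m mf _; apply: leq_trans (size_scale_leq _ _) _.
have [/forallP mE|/forallPn[i /negPf mi]] :=
  boolP [forall i, m (lshift n i) == m (rshift n i)]; last first.
  by rewrite /trace_mon (bigD1 i)//= /trace_factor mi mul0r size_poly0.
have : (mdeg m < a.*2)%N by apply: leq_trans (msize_mdeg_lt mf) fa.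
rewrite mdegE big_split_ord /=.
rewrite (eq_bigr (fun i => m (lshift n i))) => [|i _]; last by [].
rewrite [X in (_ + X)%N](eq_bigr (fun i => m (lshift n i))) => [|i _]; last first.
  by rewrite (eqP (mE i)).
rewrite addnn ltn_double => lt; apply: leq_trans lt.
rewrite /trace_mon.
elim/big_ind2: _ => [|p s q t|i _].
- by rewrite size_poly1.
- move=> ps qt; apply: leq_trans (size_polyMleq _ _) _.
  by move: ps qt; move: (size _) (size _) => k l; lia.
rewrite /trace_factor mE -polyC_natr mul_polyC.
apply: leq_trans (size_scale_leq _ _) _; apply: leq_trans (size_poly_exp_leq _ _) _.
have := c2 i; case: (size (c i)) => [|[|[|]]] //= _; by rewrite ?mul0n ?mul1n.
Qed.

Context (u : K) (t : 'I_n -> K).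
Hypothesis t_neq0 : forall i, t i != 0.
Hypothesis ct : forall i, (c i).[u] = t i * ((c i).[u] + 1).

(** Here [t i] is the scalar by which the group element will act on [x i], and [ct] says, without
    division, that [c i] takes the value t / (1 - t) at [u]. *)
Definition trace_at (f : O_V) : K := (trace_poly f).[u].

Lemma trace_atP a f g : trace_at (a *: f + g) = a * trace_at f + trace_at g.
Proof. by rewrite /trace_at linearP hornerD hornerZ. Qed.

Lemma trace_atD f g : trace_at (f + g) = trace_at f + trace_at g.
Proof. by rewrite -[f]scale1r trace_atP mul1r scale1r. Qed.

Lemma trace_atZ a f : trace_at (a *: f) = a * trace_at f.
Proof. by rewrite /trace_at linearZ hornerZ. Qed.

Let rest i (m : 'X_{1..n + n}) :=
  (\prod_(j | j != i) trace_factor j (m (lshift n j)) (m (rshift n j))).[u].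

Let factor i a b := (trace_factor i a b).[u].

Let trace_atX i m :
  trace_at 'X_[m] = factor i (m (lshift n i)) (m (rshift n i)) * rest i m.
Proof. by rewrite /trace_at trace_polyX /trace_mon (bigD1 i)//= hornerM. Qed.

Let restU i j (m : 'X_{1..n + n}) : (j = lshift n i) \/ (j = rshift n i) ->
  (rest i (U_(j) + m) = rest i m) /\ (rest i (m - U_(j)) = rest i m).
Proof.
move=> ji; split; rewrite /rest; congr (_.[u]); apply: eq_bigr => l li;
  rewrite !(mnmDE, mnmBE) !mnm1E;
  by case: ji => ->;
    rewrite ?(eq_lshift, eq_rshift, eq_lrshift, eq_rlshift) eq_sym (negPf li) ?subn0.
Qed.

Let factorE i a b : factor i a b = (a`!%:R * (c i).[u] ^+ a) *+ (a == b).
Proof.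
rewrite /factor /trace_factor; case: eqP => _; last by rewrite horner0.
by rewrite -polyC_natr mul_polyC hornerZ horner_exp.
Qed.

(** For [b = a.+1] this is [ct] multiplied by (a+1)! c^a; in all other cases both sides vanish. *)
Let factor_x i a b :
  factor i a.+1 b = t i * (factor i a.+1 b + b%:R * factor i a b.-1).
Proof.
rewrite !factorE; case: b => [|b] /=; first by rewrite !mul0r !mulr0n addr0 mulr0.
rewrite eqSS; case: eqP => [->|_]; last by rewrite !mulr0n mulr0 addr0 mulr0.
rewrite !mulr1n factS natrM exprS [X in _ * (X * _) = _]ct; ring.
Qed.

(** By [weyl_mul_x] the argument on the right is the symbol of [no f * X i], so this is twisted
    cyclicity for the generator [X i]. Only the factor of index [i] changes, and [factor_x] handles
    it. *)
Lemma trace_at_x i f : trace_at (x i * f) = t i * trace_at (x i * f + dy i f).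
Proof.
elim/mpoly_ind_monom: f => [a f g IHf IHg|m].
  rewrite mderivD mderivZ mulrDr -scalerAr addrACA -scalerDr !trace_atP IHf IHg; ring.
rewrite mderivX -mpolyXD trace_atD trace_atZ !(trace_atX i).
rewrite (restU _ (or_introl erefl)).1 (restU _ (or_intror erefl)).2.
rewrite !(mnmDE, mnmBE) !mnm1E !eqxx eq_lrshift eq_rlshift add1n add0n subn1 subn0.
by rewrite {1}factor_x; ring.
Qed.

Lemma trace_at_y i f : trace_at (y i * f) = t i * trace_at (y i * f + dx i f).
Proof.
have fC a b : factor i a b = factor i b a.
  by rewrite !factorE eq_sym; case: eqP => [->|].
elim/mpoly_ind_monom: f => [a f g IHf IHg|m].
  rewrite mderivD mderivZ mulrDr -scalerAr addrACA -scalerDr !trace_atP IHf IHg; ring.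
rewrite mderivX -mpolyXD trace_atD trace_atZ !(trace_atX i).
rewrite (restU _ (or_intror erefl)).1 (restU _ (or_introl erefl)).2.
rewrite !(mnmDE, mnmBE) !mnm1E !eqxx eq_lrshift eq_rlshift add1n add0n subn1 subn0.
by rewrite [factor i _ (_.+1)]fC [factor i _.-1 _]fC {1}factor_x; ring.
Qed.

Definition weyl_symbol (P : W) : O_V := projT1 (cid (normal_order_surj P)).

Lemma weyl_symbolK : cancel weyl_symbol no.
Proof. by move=> P; rewrite /weyl_symbol; case: cid. Qed.

Lemma normal_orderK : cancel no weyl_symbol.
Proof. by move=> f; apply: (normal_order_inj K0); rewrite weyl_symbolK. Qed.

Definition weyl_trace (P : W) : K := trace_at (weyl_symbol P).

Lemma weyl_traceE f : weyl_trace (no f) = trace_at f.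
Proof. by rewrite /weyl_trace normal_orderK. Qed.

Lemma weyl_traceP a P Q : weyl_trace (a *: P + Q) = a * weyl_trace P + weyl_trace Q.
Proof.
rewrite -[P]weyl_symbolK -[Q]weyl_symbolK -normal_order_is_linear.
by rewrite !weyl_traceE trace_atP.
Qed.

Lemma weyl_trace0 : weyl_trace 0 = 0.
Proof. by rewrite -normal_order0 weyl_traceE /trace_at linear0 horner0. Qed.

Lemma weyl_traceZ a P : weyl_trace (a *: P) = a * weyl_trace P.
Proof. by have := weyl_traceP a P 0; rewrite weyl_trace0 !addr0. Qed.

Lemma weyl_trace_x i P : weyl_trace (X i * P) = t i * weyl_trace (P * X i).
Proof.
by rewrite -[P]weyl_symbolK -normal_order_x weyl_mul_x !weyl_traceE trace_at_x.
Qed.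

Lemma weyl_trace_d i P : weyl_trace (P * D i) = t i * weyl_trace (D i * P).
Proof.
by rewrite -[P]weyl_symbolK -normal_order_y weyl_mul_d !weyl_traceE trace_at_y.
Qed.

Context (A : 'M[K]_n) (Au : A \in unitmx).
Hypothesis Ax : forall i, mpoly_act (gl_sp A) (x i) = t i *: x i.
Hypothesis Ay : forall i, mpoly_act (gl_sp A) (y i) = (t i)^-1 *: y i.

(** Twisted cyclicity extends from generators to products by carrying one generator at a time around
    the trace: [X i] picks up [t i], and [D i] its inverse. *)
Lemma weyl_trace_twist f Q :
  weyl_trace (no f * Q) = weyl_trace (Q * no (mpoly_act (gl_sp A) f)).
Proof.
elim/mpoly_ind_xy: f Q => [a f g IHf IHg Q|Q|i f IH Q|i f IH Q].
- rewrite mpoly_actD mpoly_actZ !normal_order_is_linear mulrDl mulrDr.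
  by rewrite -scalerAl -scalerAr !weyl_traceP IHf IHg.
- by rewrite mpoly_act1 normal_order1 mul1r mulr1.
- rewrite mpoly_actM Ax -scalerAl normal_orderZ !normal_order_x -scalerAr weyl_traceZ.
  by rewrite -mulrA weyl_trace_x -mulrA IH mulrA.
- rewrite mpoly_actM Ay -scalerAl normal_orderZ !normal_order_y -scalerAr weyl_traceZ.
  by rewrite -mulrA IH mulrA weyl_trace_d -!mulrA mulKf.
Qed.

(** An invariant operator is fixed by the twist, so against such operators the twisted trace is
    cyclic in the ordinary sense. *)
Lemma weyl_trace_commutators (G : set 'M[K]_n) P : G A ->
  P \in commutators G -> weyl_trace P = 0.
Proof.
move=> GA /asboolP/(_ (fun P => weyl_trace P = 0)); apply.
- exact: weyl_trace0.
- by move=> a Q S /= Q0 S0; rewrite weyl_traceP Q0 S0 mulr0 addr0.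
move=> _ [Q [S [GQ ->]]].
have AQ : no (mpoly_act (gl_sp A) (weyl_symbol Q)) = Q.
  apply/weylP => p; rewrite -normal_order_act// weyl_symbolK.
  by have /(congr1 (fun h => h p)) := GQ _ GA.
have := weyl_trace_twist (weyl_symbol Q) S; rewrite AQ weyl_symbolK => QS.
by rewrite addrC -scaleN1r weyl_traceP QS mulN1r addNr.
Qed.

End TwistedTrace.

(** * The group G(m,m,2) *)

Lemma sum_scale_single (F : fieldType) (V : lmodType F) n (j : 'I_n)
    (a : 'I_n -> F) (v : 'I_n -> V) :
  (forall l, l != j -> a l = 0) -> \sum_l a l *: v l = a j *: v j.
Proof.
move=> a0; rewrite (bigD1 j)//= big1 ?addr0// => l lj.
by rewrite a0// scale0r.
Qed.

(** * Composition of linear actions on polynomials *)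

Section ActionGroup.
Context (K : fieldType).

Lemma mulmx1_invmx k (A B : 'M[K]_k) : A *m B = 1%:M -> invmx A = B.
Proof.
by move=> AB1; have [Au _] := mulmx1_unit AB1; rewrite -[B](mulKmx Au) AB1 mulmx1.
Qed.

Lemma invmxM k (A B : 'M[K]_k) : A \in unitmx -> B \in unitmx ->
  invmx (A *m B) = invmx B *m invmx A.
Proof.
by move=> Au Bu; apply: mulmx1_invmx; rewrite mulmxA mulmxK// mulmxV.
Qed.

Lemma mpoly_act_mul k (A B : 'M[K]_k) f : A \in unitmx -> B \in unitmx ->
  mpoly_act (A *m B) f = mpoly_act A (mpoly_act B f).
Proof.
move=> Au Bu; elim/mpoly_ind_mulX: f => [a f g IHf IHg||i f IH].
- by rewrite !(mpoly_actD, mpoly_actZ) IHf IHg.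
- by rewrite !mpoly_act1.
rewrite [LHS]mpoly_actM [mpoly_act B _]mpoly_actM [RHS]mpoly_actM IH.
suff -> : mpoly_act (A *m B) 'X_i = mpoly_act A (mpoly_act B 'X_i) by [].
rewrite [LHS]mpoly_actXU [mpoly_act B _]mpoly_actXU mpoly_act_sum.
under [RHS]eq_bigr => j _.
  rewrite mpoly_actZ mpoly_actXU scaler_sumr.
  under eq_bigr do rewrite scalerA.
  over.
rewrite exchange_big; apply: eq_bigr => j _.
by rewrite -scaler_suml (invmxM Au Bu) mxE.
Qed.

Lemma unitmx_gl_sp n (A : 'M[K]_n) : A \in unitmx -> gl_sp A \in unitmx.
Proof.
move=> Au; rewrite unitmxE det_lblock unitrM -!unitmxE Au.
by rewrite unitmx_tr unitmx_inv.
Qed.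

Lemma gl_spM n (A B : 'M[K]_n) : A \in unitmx -> B \in unitmx ->
  gl_sp (A *m B) = gl_sp A *m gl_sp B.
Proof.
move=> Au Bu; rewrite /gl_sp mulmx_block !(mulmx0, mul0mx) !addr0 add0r.
by rewrite invmxM// trmx_mul.
Qed.

Lemma mpoly_act_1mx k (f : {mpoly K[k]}) : mpoly_act 1%:M f = f.
Proof.
elim/mpoly_ind_mulX: f => [a f g IHf IHg||i f IH].
- by rewrite mpoly_actD mpoly_actZ IHf IHg.
- by rewrite mpoly_act1.
rewrite mpoly_actM IH mpoly_actXU invmx1 (sum_scale_single (j := i)) => [|j ji].
  by rewrite mxE eqxx scale1r.
by rewrite mxE eq_sym (negPf ji).
Qed.

Lemma gl_sp_act1 n (f : {mpoly K[n + n]}) : mpoly_act (gl_sp 1%:M) f = f.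
Proof. by rewrite /gl_sp invmx1 trmx1 -scalar_mx_block mpoly_act_1mx. Qed.

Lemma gl_sp_actM n (A B : 'M[K]_n) f : A \in unitmx -> B \in unitmx ->
  mpoly_act (gl_sp (A *m B)) f = mpoly_act (gl_sp A) (mpoly_act (gl_sp B) f).
Proof.
move=> Au Bu; rewrite (gl_spM Au Bu).
by apply: mpoly_act_mul; apply: unitmx_gl_sp.
Qed.

Lemma gl_sp_actV n (A : 'M[K]_n) f : A \in unitmx ->
  mpoly_act (gl_sp A) f = f -> mpoly_act (gl_sp (invmx A)) f = f.
Proof.
move=> Au {1}<-; rewrite -gl_sp_actM ?unitmx_inv//.
by rewrite mulVmx// gl_sp_act1.
Qed.

End ActionGroup.

(** With q = z^(-k) and u = 1 / (1 - q), one has u - 1 = q / (1 - q) and -u = q^(-1) / (1 - q^(-1)):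
    the values of t / (1 - t) for the two eigenvalues t of a rotation. *)
Lemma trace_root_identity (F : fieldType) (z : F) k :
  z ^+ k != 0 -> 1 - z^-1 ^+ k != 0 ->
  (1 - z^-1 ^+ k)^-1 - 1 = z^-1 ^+ k * ((1 - z^-1 ^+ k)^-1 - 1 + 1) /\
  - (1 - z^-1 ^+ k)^-1 = z ^+ k * (- (1 - z^-1 ^+ k)^-1 + 1).
Proof.
rewrite exprVn; move: (z ^+ k) => v v0 v1.
have v1' : v - 1 != 0.
  by apply: contraNneq v1 => /subr0_eq ->; rewrite invr1 subrr.
by split; field; rewrite v0 v1'.
Qed.

(** * Trace polynomials of the generators *)

Section TraceCoef.
Context (F : fieldType).

Definition trace_coef (i : 'I_2) : {poly F} := if i == 0 then 'X - 1 else - 'X.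

(** The sign in the generator cancels that of [(- 'X) ^+ a], so the two leading coefficients add up
    for every [a]. *)
Lemma trace_HP0_gen a : trace_poly trace_coef (HP0_gen F a) =
  a`!%:R * (('X - 1) ^+ a + 'X ^+ a).
Proof.
have signE (f : {mpoly F[2 + 2]}) : (-1) ^+ a * f = (-1) ^+ a *: f.
  by rewrite -(signr_odd {mpoly F[2 + 2]} a) -(signr_odd F a) mulr_sign scaler_sign.
have -> : HP0_gen F a = (-1) ^+ a *: (coord_x F 1 ^+ a * coord_y F 1 ^+ a)
    + coord_x F 0 ^+ a * coord_y F 0 ^+ a by rewrite /HP0_gen signE addrC.
rewrite trace_poly_is_linear !trace_poly_xy /trace_coef eqxx.
rewrite [1 == 0](_ : _ = false)// addrC mulrDr; congr (_ + _).
rewrite scalerAr; congr (_ * _); rewrite [(- 'X) ^+ a]exprNn.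
rewrite -(signr_odd {poly F} a) -(signr_odd F a) mulr_sign scaler_sign.
by case: odd; rewrite ?opprK.
Qed.

Lemma size_trace_coef i : (size (trace_coef i) <= 2)%N.
Proof.
rewrite /trace_coef; case: ifP => _; rewrite ?size_polyN ?size_polyX//.
by rewrite -[1]/(1%:P) size_XsubC.
Qed.

End TraceCoef.

Section Swap.
Context (F : fieldType).

Definition swap_mx : 'M[F]_2 := \matrix_(i, j) (i != j)%:R.

Lemma swap_mxK : swap_mx *m swap_mx = 1%:M.
Proof.
apply/matrixP => i j; rewrite !mxE !big_ord_recl big_ord0 !mxE addr0.
case: i => [[|[|//]] i2]; case: j => [[|[|//]] j2];
  by rewrite /= ?(mul0r, mulr0, mul1r, add0r, addr0).
Qed.

Lemma act_swap_mx (i j : 'I_2) : i != j ->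
  mpoly_act (gl_sp swap_mx) (coord_x F i) = coord_x F j /\
  mpoly_act (gl_sp swap_mx) (coord_y F i) = coord_y F j.
Proof.
move=> ij; have [Su _] := mulmx1_unit swap_mxK.
have other (l : 'I_2) : l != j -> l = i.
  move: l i j ij => [[|[|//]] ?] [[|[|//]] ?] [[|[|//]] ?] //= _ _; exact: val_inj.
have sij : swap_mx i j = 1 by rewrite mxE ij.
have sji : swap_mx j i = 1 by rewrite mxE eq_sym ij.
rewrite (mpoly_act_gl_sp_x _ Su) (mpoly_act_gl_sp_y _ Su) (mulmx1_invmx swap_mxK).
split; rewrite (sum_scale_single (j := j)).
- by rewrite sij scale1r.
- by move=> l /other ->; rewrite mxE eqxx.
- by rewrite sji scale1r.
- by move=> l /other ->; rewrite mxE eqxx.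
Qed.

End Swap.

(** * Rotations, invariants and independence of the generators *)

Section Gmm2Theory.
Context (R : realType).
Local Notation K := R[i].
Local Notation x := (@coord_x K 2).
Local Notation y := (@coord_y K 2).

Lemma expiD (s t : R) : expi (s + t) = expi s * expi t.
Proof. by rewrite /expi cosD sinD; apply/eqP; rewrite eq_complex /= eqxx /= addrC. Qed.

Lemma expi0 : expi (0 : R) = 1.
Proof. by rewrite /expi cos0 sin0. Qed.

Lemma expi_mul_nat (t : R) k : expi (t *+ k) = expi t ^+ k.
Proof. by elim: k => [|k IH]; rewrite ?expi0// mulrS expiD exprS IH. Qed.

Lemma expi_mulN (t : R) : expi t * expi (- t) = 1.
Proof. by rewrite -expiD subrr expi0. Qed.

Lemma expi_neq0 (t : R) : expi t != 0.
Proof.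
apply/eqP => t0; have := expi_mulN t; rewrite t0 mul0r => /esym/eqP.
by rewrite oner_eq0.
Qed.

Lemma expiN (t : R) : expi (- t) = (expi t)^-1.
Proof. by apply: (mulfI (expi_neq0 t)); rewrite expi_mulN divff// expi_neq0. Qed.

(** By the half-angle formulas cos t = 1 would force sin (t / 2) = 0, although t / 2 lies strictly
    between 0 and pi. *)
Lemma expi_neq1 (t : R) : 0 < t < pi *+ 2 -> expi t != 1.
Proof.
move=> /andP[t0 t2]; apply/eqP => /eqP; rewrite eq_complex /= => /andP[/eqP c1 _].
have s0 : 0 < sin (t / 2).
  by apply: sin_gt0_pi; rewrite divr_gt0//= ltr_pdivrMr// mulr_natr.
have := sin2cos2 (t / 2); have := cos_mulr2n (t / 2).
rewrite -[_ *+ 2]mulr_natr divfK ?pnatr_eq0// c1 => /eqP.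
rewrite eq_sym subr_eq -mulr2n -subr_eq0 -mulrnBl mulrn_eq0 /= subr_eq0 => /eqP ->.
by rewrite subrr => /eqP; rewrite sqrf_eq0 (gt_eqF s0).
Qed.

Section Fixed.
Context (m : nat) (m_gt1 : (1 < m)%N).
Local Notation w := (expi (2 * pi / m%:R : R)).
Local Notation G := (@Gmm2 R m).

Let m_neq0 : m%:R != 0 :> R. Proof. by rewrite pnatr_eq0 -lt0n ltnW. Qed.
Let w_neq0 : w != 0. Proof. exact: expi_neq0. Qed.

Lemma expi_root : w ^+ m = 1.
Proof.
rewrite -expi_mul_nat -[_ *+ m]mulr_natr divfK ?m_neq0// mulr_natl.
by rewrite /expi cos2pi sin2pi.
Qed.

Lemma expi_prim k : (0 < k < m)%N -> w ^+ k != 1.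
Proof.
move=> /andP[k0 km]; rewrite -expi_mul_nat; apply: expi_neq1.
have pi2 : 0 < 2 * pi :> R by rewrite mulr_gt0 ?pi_gt0.
have m0 : 0 < m%:R :> R by rewrite ltr0n ltnW.
rewrite pmulrn_lgt0// divr_gt0//= -[pi *+ 2]mulr_natl -[_ *+ k]mulr_natr.
by rewrite mulrAC ltr_pdivrMr// ltr_pM2l// ltr_nat.
Qed.

(** Coordinates are functions, so [rot_gen] acts on [x i] by the inverse of its diagonal entry. *)
Definition rot_scalar (i : 'I_2) : K := if i == 0 then w^-1 else w.

Lemma rot_scalar_neq0 i : rot_scalar i != 0.
Proof. by rewrite /rot_scalar; case: ifP => _; rewrite ?invr_eq0. Qed.

Lemma rot_genE i j : rot_gen R m i j = if i != j then 0 else (rot_scalar i)^-1.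
Proof.
rewrite mxE; case: eqP => //= _; rewrite /rot_scalar; case: ifP => _.
  by rewrite mul1r invrK.
by rewrite mulN1r expiN.
Qed.

Lemma rot_mulV :
  rot_gen R m *m (\matrix_(i, j) if i != j then 0 else rot_scalar i) = 1%:M.
Proof.
apply/matrixP => i j; rewrite !mxE (bigD1 i)//= rot_genE eqxx mxE.
rewrite big1 ?addr0 => [|l li]; last by rewrite rot_genE eq_sym li mul0r.
by case: eqP => [->|_] /=; rewrite ?mulr0// mulVf ?rot_scalar_neq0.
Qed.

Lemma invmx_rot : invmx (rot_gen R m) =
  \matrix_(i, j) if i != j then 0 else rot_scalar i.
Proof. exact: mulmx1_invmx rot_mulV. Qed.

Lemma unitmx_rot : rot_gen R m \in unitmx.
Proof.
exact: (mulmx1_unit rot_mulV).1.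
Qed.

Lemma swap_swap : swap_gen R *m swap_gen R = 1%:M.
Proof. exact: swap_mxK. Qed.

Lemma unitmx_swap : swap_gen R \in unitmx.
Proof. by have [] := mulmx1_unit swap_swap. Qed.

Lemma Gmm2_unitmx A : G A -> A \in unitmx.
Proof.
elim=> [|||B C _ Bu _ Cu|B _ Bu]; rewrite ?unitmx1 ?unitmx_swap//.
- exact: unitmx_rot.
- by rewrite unitmx_mul Bu.
- by rewrite unitmx_inv.
Qed.

Lemma Gmm2_invariant f : mpoly_act (gl_sp (rot_gen R m)) f = f ->
  mpoly_act (gl_sp (swap_gen R)) f = f -> O_V_invariant G f.
Proof.
move=> rotf swapf A.
elim=> [||| B C /Gmm2_unitmx Bu Bf /Gmm2_unitmx Cu Cf | B /Gmm2_unitmx Bu Bf].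
- exact: rotf.
- exact: swapf.
- exact: gl_sp_act1.
- rewrite (gl_sp_actM f Bu Cu) Cf; exact: Bf.
- exact: gl_sp_actV.
Qed.

Lemma act_rot_x i : mpoly_act (gl_sp (rot_gen R m)) (x i) = rot_scalar i *: x i.
Proof.
rewrite (mpoly_act_gl_sp_x _ unitmx_rot) (sum_scale_single (j := i)) => [|j ji].
  by rewrite invmx_rot mxE eqxx.
by rewrite invmx_rot mxE eq_sym ji.
Qed.

Lemma act_rot_y i : mpoly_act (gl_sp (rot_gen R m)) (y i) = (rot_scalar i)^-1 *: y i.
Proof.
rewrite (mpoly_act_gl_sp_y _ unitmx_rot) (sum_scale_single (j := i)) => [|j ji].
  by rewrite rot_genE eqxx.
by rewrite rot_genE ji.
Qed.

Lemma act_swap : [/\ mpoly_act (gl_sp (swap_gen R)) (x 0) = x 1,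
  mpoly_act (gl_sp (swap_gen R)) (x 1) = x 0,
  mpoly_act (gl_sp (swap_gen R)) (y 0) = y 1 &
  mpoly_act (gl_sp (swap_gen R)) (y 1) = y 0].
Proof.
have [s0 t0] := @act_swap_mx K 0 1 isT; have [s1 t1] := @act_swap_mx K 1 0 isT.
by split.
Qed.

Fixpoint rot_pow k : 'M[K]_2 := if k is l.+1 then rot_gen R m *m rot_pow l else 1%:M.

Lemma Gmm2_rot_pow k : G (rot_pow k).
Proof.
elim: k => [|k IH]; first exact: Gmm2_one.
by apply: Gmm2_mul IH; apply: Gmm2_rot.
Qed.

Lemma act_rot_pow_x k i :
  mpoly_act (gl_sp (rot_pow k)) (x i) = rot_scalar i ^+ k *: x i.
Proof.
elim: k => [|k IH].
  rewrite (mpoly_act_gl_sp_x _ (unitmx1 _ _)) invmx1.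
  rewrite (sum_scale_single (j := i)) => [|j ji].
    by rewrite mxE eqxx.
  by rewrite mxE eq_sym (negPf ji).
have Ru := Gmm2_unitmx (Gmm2_rot_pow k).
rewrite [rot_pow _]/= (gl_sp_actM _ unitmx_rot Ru).
by rewrite IH mpoly_actZ act_rot_x scalerA exprSr.
Qed.

Lemma act_rot_pow_y k i :
  mpoly_act (gl_sp (rot_pow k)) (y i) = (rot_scalar i ^+ k)^-1 *: y i.
Proof.
elim: k => [|k IH].
  rewrite (mpoly_act_gl_sp_y _ (unitmx1 _ _)) (sum_scale_single (j := i)) => [|j ji].
    by rewrite mxE eqxx invr1.
  by rewrite mxE (negPf ji).
have Ru := Gmm2_unitmx (Gmm2_rot_pow k).
rewrite [rot_pow _]/= (gl_sp_actM _ unitmx_rot Ru).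
by rewrite IH mpoly_actZ act_rot_y scalerA exprS invfM mulrC.
Qed.

Lemma invariant_xx : O_V_invariant G (x 0 * x 1).
Proof.
have [s0 s1 _ _] := act_swap; apply: Gmm2_invariant; rewrite mpoly_actM.
  by rewrite !act_rot_x -scalerAl -scalerAr scalerA mulVf// scale1r.
by rewrite s0 s1 mulrC.
Qed.

Lemma invariant_xy : O_V_invariant G (x 0 * y 0 + x 1 * y 1).
Proof.
have [s0 s1 s2 s3] := act_swap; apply: Gmm2_invariant; rewrite mpoly_actD !mpoly_actM.
  rewrite !act_rot_x !act_rot_y -!scalerAl -!scalerAr !scalerA.
  by rewrite !mulfV ?rot_scalar_neq0// !scale1r.
by rewrite s0 s1 s2 s3 addrC.
Qed.

Lemma mpoly_act_exp k (A : 'M[K]_k) f e : mpoly_act A (f ^+ e) = mpoly_act A f ^+ e.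
Proof. by elim: e => [|e IH]; rewrite ?mpoly_act1// !exprS mpoly_actM IH. Qed.

Lemma invariant_xm : O_V_invariant G (x 0 ^+ m + x 1 ^+ m).
Proof.
have [s0 s1 _ _] := act_swap; apply: Gmm2_invariant; rewrite mpoly_actD !mpoly_act_exp.
  by rewrite !act_rot_x !exprZn /rot_scalar /= exprVn expi_root invr1 !scale1r.
by rewrite s0 s1 addrC.
Qed.

Lemma pchar_complex : [pchar K] =i pred0. Proof. exact: Num.Theory.pchar_num. Qed.

Lemma HP0_gen_homog a : @HP0_gen K a \is (2 * a).-homog.
Proof.
have H (i : 'I_2) : x i ^+ a * y i ^+ a \is [in K[2 + 2], (2 * a).-homog].
  rewrite -[(2 * a)%N]/((1 + 1) * a)%N mulnDl.
  by apply: dhomogM; apply: dhomogMn; rewrite dhomogX; apply/eqP/mdeg1.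
rewrite rpredD ?H// -signr_odd mulr_sign.
by case: odd; rewrite ?rpredN H.
Qed.

Local Notation trace_coef := (@trace_coef K).

Lemma trace_root k : (0 < k < m)%N -> forall i,
  (trace_coef i).[(1 - w^-1 ^+ k)^-1] =
  rot_scalar i ^+ k * ((trace_coef i).[(1 - w^-1 ^+ k)^-1] + 1).
Proof.
move=> km i; have w1 : 1 - w^-1 ^+ k != 0.
  by rewrite subr_eq0 eq_sym exprVn invr_eq1 expi_prim.
have wk0 : w ^+ k != 0 by rewrite expf_neq0.
have [E0 E1] := trace_root_identity wk0 w1.
rewrite /trace_coef /rot_scalar; case: ifP => _.
  by rewrite hornerD hornerX hornerN hornerC; apply: E0.
by rewrite hornerN hornerX; apply: E1.
Qed.

Lemma trace_root_inj k l : (0 < k < m)%N -> (0 < l < m)%N ->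
  (1 - w^-1 ^+ k)^-1 = (1 - w^-1 ^+ l)^-1 -> k = l.
Proof.
wlog kl : k l / (k <= l)%N => [H|].
  by move=> km lm E; case: (leqP k l) => [|/ltnW] kl; [apply: H | apply/esym/H].
move=> /andP[k0 km] /andP[l0 lm] /invr_inj/addrI/oppr_inj; rewrite !exprVn => /invr_inj.
move: kl; rewrite leq_eqVlt => /predU1P[//|kl] E.
have lk : (0 < l - k < m)%N by lia.
case/negP: (expi_prim lk).
apply/eqP/(mulfI (expf_neq0 k w_neq0)).
by rewrite mulr1 -exprD subnKC// ltnW.
Qed.

(** Independence is obtained already in gr HH_0; this implies independence in HP_0 and, with
    [HP0_span], the injectivity of the symbol map. *)
Lemma HP0_gen_free (c : 'I_m.-1 -> K) :
  symbol_map G (\sum_i c i *: HP0_gen K i) = 0 -> forall i, c i = 0.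
Proof.
move=> c0 a; set f := \sum_i _ in c0.
(* The generators have distinct degrees, so one homogeneous part isolates one coefficient. *)
have pif : pihomog mdeg (2 * a)%N f = c a *: HP0_gen K a.
  rewrite /f linear_sum (bigD1 a)//= big1 => [|i ia].
    by rewrite addr0 linearZ /= pihomog_dE// HP0_gen_homog.
  rewrite linearZ /= (@pihomog_ne0 _ _ _ (2 * i)%N) ?HP0_gen_homog ?scaler0//.
  by rewrite eqn_mul2l.
have : symbol_component G (2 * a)%N f = 0.
  by have /dsumP/(_ (2 * a)%N) := c0.
move=> /symbol_component_eq0[_ /bernsteinP[g ga ->]]; rewrite pif => cg.
pose p := trace_poly trace_coef (c a *: HP0_gen K a - g).
(* The lower order term [g] has degree below [2 * a], so it cannot affect the coefficient of degree
   [a]. *)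
have sg : (size (trace_poly trace_coef g) <= a)%N.
  by apply: size_trace_poly => [i|]; [exact: size_trace_coef | rewrite -mul2n].
have pE : p = (c a * a`!%:R) *: (('X - 1) ^+ a + 'X ^+ a) - trace_poly trace_coef g.
  rewrite /p linearB linearZ /= trace_HP0_gen -polyC_natr mul_polyC.
  by rewrite scalerA.
have sp : (size p <= a.+1)%N.
  rewrite pE; apply: leq_trans (size_polyD _ _) _; rewrite size_polyN geq_max.
  rewrite (leq_trans sg)// andbT; apply: leq_trans (size_scale_leq _ _) _.
  apply: leq_trans (size_polyD _ _) _; rewrite geq_max size_polyXn leqnn andbT.
  by rewrite -[1]/(1%:P) size_exp_XsubC.
have p0 : p = 0.
  apply/eqP; apply: contraT => p_neq0.
  (* One root for each nontrivial rotation: [m.-1] roots against a degree of at most [a], which is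
     less than [m.-1]. *)
  pose rs := [seq (1 - w^-1 ^+ k.+1)^-1 | k <- iota 0 m.-1].
  have := @max_poly_roots _ p rs p_neq0.
  have -> : all (root p) rs.
    apply/allP => z /mapP[k]; rewrite mem_iota add0n => km -> {z}.
    have km' : (0 < k.+1 < m)%N by lia.
    apply/eqP; pose t i := rot_scalar i ^+ k.+1.
    have t0 i : t i != 0 by rewrite expf_neq0 ?rot_scalar_neq0.
    rewrite -[p.[_]]/(trace_at trace_coef _ _).
    rewrite -(weyl_traceE pchar_complex) normal_orderB.
    apply: (weyl_trace_commutators pchar_complex t0 (trace_root km')
      (Gmm2_unitmx (Gmm2_rot_pow k.+1)) _ _ (Gmm2_rot_pow k.+1) cg).
      by move=> i; apply: act_rot_pow_x.
    by move=> i; apply: act_rot_pow_y.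
  have -> : uniq rs.
    rewrite map_inj_in_uniq ?iota_uniq// => k l; rewrite !mem_iota !add0n => km lm E.
    by apply: succn_inj; apply: trace_root_inj E; lia.
  rewrite size_map size_iota => /(_ isT isT) lt.
  by have := leq_trans lt sp; rewrite ltnS leqNgt ltn_ord.
have /eqP : p`_a = 0 by rewrite p0 coef0.
rewrite pE coefB coefZ coefD coefXn eqxx [X in _ - X]nth_default// subr0.
(* Both powers are monic, so the coefficient of degree [a] in [p] is [c a] times twice a
   factorial. *)
have -> : (('X - 1) ^+ a : {poly K})`_a = 1.
  have := lead_coef_exp ('X - 1%:P : {poly K}) a.
  by rewrite lead_coefXsubC expr1n lead_coefE size_exp_XsubC.
rewrite mulf_eq0 mulf_eq0 -[1 + 1]/(2%:R) !((pcharf0P K).1 pchar_complex).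
by rewrite -[_ == 0%N]negbK -lt0n fact_gt0 !orbF => /eqP.
Qed.

End Fixed.
End Gmm2Theory.

Theorem theorem7p26 (R : realType) (m : nat) (hm : (2 <= m)%N) :
  (exists phi : {linear HP0 (@Gmm2 R m) -> grHH0 (@Gmm2 R m)},
     (forall (k : nat) (f : dhomog (2 + 2) R[i] k),
        phi (qproj (pbrackets (@Gmm2 R m)) f) = symbol_class (@Gmm2 R m) f) /\
     bijective phi) /\
  (forall a : 'I_m.-1, @HP0_generator R a \is (2 * a).-homog) /\
  is_basis (fun a : 'I_m.-1 =>
    qproj (pbrackets (@Gmm2 R m)) (@HP0_generator R a)).
Proof.
have Gu := @Gmm2_unitmx R m.
pose G := @Gmm2 R m.
have span := HP0_span (@pchar_complex R) (ltnW hm) (@invariant_xx R m)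
  (@invariant_xy R m) (@invariant_xm R m hm).
pose phi : {linear HP0 G -> grHH0 G} := HP0_symbol_linear Gu.
have phiE f : phi (qproj (pbrackets G) f) = symbol_map G f by apply: HP0_symbolE.
have phi_gen (c : 'I_m.-1 -> R[i]) :
    phi (\sum_i c i *: qproj (pbrackets G) (HP0_gen _ i)) = 0 -> forall i, c i = 0.
  move=> c0; apply: (HP0_gen_free hm); rewrite -c0 -phiE; congr (phi _).
  by rewrite linear_sum; apply: eq_bigr => i _; rewrite linearZ.
split; [exists phi; split => [k f|] | split => [a|]].
- by rewrite phiE; apply: symbol_map_dhomog.
(* By [span] an element of the kernel is a combination of the generators, and [phi_gen] makes its
   coefficients vanish. *)
- have phi_inj : injective phi.
    apply: raddf_inj => q; have [c ->] := span q => /phi_gen c0.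
    by rewrite big1// => i _; rewrite c0 scale0r.
  have [psi psiK] := choice (HP0_symbol_surj (G := G) Gu).
  exists psi => [q|z]; last exact: psiK.
  by apply: phi_inj; apply: psiK.
- exact: HP0_gen_homog.
- split=> [c c0|q]; last exact: span.
  by apply: phi_gen; rewrite [X in phi X]c0 linear0.
Qed.
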